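(* Let $\sigma>0$, $\alpha>0$, $\Lambda = \frac{1}{\sigma}\sqrt{\Gamma(3/\alpha)/\Gamma(1/\alpha)}$, and let $(X_i)_{i\ge1}$ be independent and identically distributed real random variables with $\mathbb{E}[X_i]=0$, $\mathbb{E}|X_i|<\infty$, and density $$f_{X_1}(z) = \frac{\alpha\Lambda^2}{\Gamma(1/\alpha)^2} K_0\!\left(2\Lambda^\alpha |z|^{\alpha/2}\right), \quad z\in\mathbb{R}.$$ Let $S_n = \sum_{i=1}^n X_i$. Then for every $n \ge 1$, $$\mathbb{E}|S_n| \ \ge\ \sqrt{n}\,\frac{\Gamma(2/\alpha)^2}{\Lambda^2\,\Gamma(1/\alpha)^2} \;=\; \sqrt{n}\,\frac{\sigma^2\,\Gamma(2/\alpha)^2}{\Gamma(1/\alpha)\,\Gamma(3/\alpha)}.$$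
   Context: $K_0$ is the modified Bessel function of the second kind of order $0$; $\Gamma$ is the Euler Gamma function. The given density is that of the product of two independent generalized normal variables with density $\frac{\alpha\Lambda}{2\Gamma(1/\alpha)} e^{-\Lambda^\alpha |x|^\alpha}$. *)

(* Defs.v *)
From HB Require Import structures.
From mathcomp Require Import all_boot all_order all_algebra.
From mathcomp Require Import all_classical all_reals all_analysis.
Set Implicit Arguments. Unset Strict Implicit. Unset Printing Implicit Defensive.
Import Order.TTheory GRing.Theory Num.Theory.
Import numFieldNormedType.Exports.
Local Open Scope classical_set_scope.
Local Open Scope ring_scope.

Definition Gamma (R : realType) (s : R) : R :=
  Rintegral (@lebesgue_measure R) `]0%R, +oo[%classic
    (fun t => powR t (s - 1) * expR (- t)).

Definition besselK0 (R : realType) (x : R) : R :=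
  Rintegral (@lebesgue_measure R) `[0%R, +oo[%classic
    (fun t => expR (- (x * ((expR t + expR (- t)) / 2)))).

Definition mutually_independent d (T : measurableType d) (R : realType)
  (P : probability T R) (X : nat -> T -> R) : Prop :=
  forall (s : seq nat) (B : nat -> set R),
    uniq s -> (forall i, measurable (B i)) ->
    P (\big[setI/setT]_(i <- s) (X i @^-1` B i)) =
    (\prod_(i <- s) P (X i @^-1` B i))%E.

(* Main.v *)
Require Import Defs.
From HB Require Import structures.
From mathcomp Require Import all_boot all_order all_algebra.
From mathcomp Require Import all_classical all_reals all_analysis.
From mathcomp Require Import ring lra measurable_realfun.
Import Order.TTheory GRing.Theory Num.Theory.
Import numFieldNormedType.Exports.
Local Open Scope classical_set_scope.
Local Open Scope ring_scope.
Set Implicit Arguments.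
Unset Strict Implicit.
Unset Printing Implicit Defensive.

(* Put F_r(s) = (1/2) \int_(-r)^r |s + u| du. Since r |s| <= F_r(s) <= r |s| + r^2 / 2, a comparison
   of E F_r(S_n) with E F_r(G) for all r > 0 yields one of E|S_n| with E|G| as r tends to 0.

   One term. K_0 is a mixture of functions log_+(w / |z|): X_1 has the law of a mixture of the
   densities log_+(w / |z|) / (2 w). The function w |-> E F_r under such a density, weighted suitably,
   lies above a tangent, so by Jensen E F_r(X_1) is at least its value for the single density with
   the same first absolute moment m = E|X_1|; an explicit estimate bounds the latter from below by
   E F_r(G_1), where G_1 is a centred Gaussian variable with E|G_1| = m.

   Many terms. If E F_r(A) <= E F_r(B) for all r, and Y is symmetric and unimodal, independent of A
   and B, then E F_r(A + Y) <= E F_r(B + Y) for all r: Y is a mixture of symmetric uniform variables,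
   and the sum of two such is again a mixture of such. Replacing the X_i by Gaussian variables one
   at a time gives E F_r(S_n) >= E F_r(G_n) with G_n Gaussian and E|G_n| = sqrt n m. *)

(** * Tonelli's theorem on subdomains and the test functions *)

(** The obvious order to carry through sums is the convex one, comparison of all E|X - a|, but it
    can fail. A law with density log_+(w / |z|) / (2 w) lives on [-w, w], so E|X - a| = a for a >=
    w, whereas E|G - a| > a for a Gaussian G. Averaging over [-r, r] weakens the order enough: for r
    >= w only second moments matter, and w^2 / 9 exceeds the Gaussian variance pi w^2 / 32 that
    belongs to the same first absolute moment w / 4. The price is that the weaker order survives the
    addition of symmetric unimodal variables only; hence one summand is exchanged at a time, next to
    one known to be of this kind. The factor r in F_r makes the stability identity free of weights:
    the integral of F_r(s + x) over |x| <= u is that of F_z(s) over |r - u| <= z <= r + u. The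
    logarithms arise because a generalized normal law is a scale mixture of symmetric uniform laws,
    and log_+(w / |z|) / (2 w) is the density of w times the product of two independent uniform
    variables on [-1, 1]. *)

Section tonelli.
Context (R : realType) (d1 d2 : measure_display) (T1 : measurableType d1) (T2 : measurableType d2).
Variables (m1 : {sigma_finite_measure set T1 -> \bar R}) (m2 : {sigma_finite_measure set T2 -> \bar R}).

(** Indicators extend the integrand by 0. Measurability and sign are asked for on the whole product,
    which is why several later integrands carry an absolute value or a power [^ (-1)] that changes
    nothing on the domain of integration. *)
Lemma tonelliD (A : set T1) (B : set T2) (f : T1 -> T2 -> \bar R) :
  measurable A -> measurable B ->
  measurable_fun setT (fun p : T1 * T2 => f p.1 p.2) ->
  (forall x y, 0 <= f x y)%E ->
  (\int[m1]_(x in A) \int[m2]_(y in B) f x y =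
   \int[m2]_(y in B) \int[m1]_(x in A) f x y)%E.
Proof.
move=> mA mB mf f0.
pose g (p : T1 * T2) : \bar R := ((\1_A p.1 * \1_B p.2)%:E * f p.1 p.2)%E.
have mg : measurable_fun setT g.
  apply: emeasurable_funM => //; apply/measurable_EFinP; apply: measurable_funM.
    by apply: (@measurableT_comp _ _ _ _ _ _ (\1_A : T1 -> R) setT fst).
  by apply: (@measurableT_comp _ _ _ _ _ _ (\1_B : T2 -> R) setT snd).
have g0 p : (0 <= g p)%E by rewrite mule_ge0// lee_fin mulr_ge0.
have := @fubini_tonelli _ _ _ _ _ m1 m2 g mg g0.
have E1 : (\int[m1]_x \int[m2]_y g (x, y) = \int[m1]_(x in A) \int[m2]_(y in B) f x y)%E.
  rewrite [RHS]integral_mkcond; apply: eq_integral => x _.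
  rewrite patchE; case: ifPn => xA; last first.
    by apply: integral0_eq => y _; rewrite /g/= indicE (negbTE xA) mul0r mul0e.
  rewrite [RHS]integral_mkcond; apply: eq_integral => y _.
  rewrite patchE /g/= !indicE xA mul1r; case: ifPn => yB; first by rewrite mul1e.
  by rewrite mul0e.
have E2 : (\int[m2]_y \int[m1]_x g (x, y) = \int[m2]_(y in B) \int[m1]_(x in A) f x y)%E.
  rewrite [RHS]integral_mkcond; apply: eq_integral => y _.
  rewrite patchE; case: ifPn => yB; last first.
    by apply: integral0_eq => x _; rewrite /g/= !indicE (negbTE yB) mulr0 mul0e.
  rewrite [RHS]integral_mkcond; apply: eq_integral => x _.
  rewrite patchE /g/= !indicE yB mulr1; case: ifPn => xA; first by rewrite mul1e.
  by rewrite mul0e.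
by rewrite E1 E2.
Qed.

Lemma measurable_integral_l (f : T1 -> T2 -> \bar R) :
  measurable_fun setT (fun p : T1 * T2 => f p.1 p.2) ->
  (forall x y, 0 <= f x y)%E ->
  measurable_fun setT (fun y => \int[m1]_x f x y)%E.
Proof.
move=> mf f0.
by have := @measurable_fun_fubini_tonelli_G _ _ _ _ _ m1 _ mf (fun p => f0 _ _).
Qed.

Lemma measurable_integral_r (f : T1 -> T2 -> \bar R) :
  measurable_fun setT (fun p : T1 * T2 => f p.1 p.2) ->
  (forall x y, 0 <= f x y)%E ->
  measurable_fun setT (fun x => \int[m2]_y f x y)%E.
Proof.
move=> mf f0.
by have := @measurable_fun_fubini_tonelli_F _ _ _ _ _ m2 _ mf (fun p => f0 _ _).
Qed.

Lemma measurable_integralD_r (B : set T2) (f : T1 -> T2 -> R) : measurable B ->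
  measurable_fun setT (fun p : T1 * T2 => f p.1 p.2) ->
  (forall x y, 0 <= f x y) ->
  measurable_fun setT (fun x => \int[m2]_(y in B) (f x y)%:E)%E.
Proof.
move=> mB mf f0.
rewrite (_ : (fun _ => _) = (fun x => \int[m2]_y (\1_B y * f x y)%:E)%E); last first.
  apply/funext => x; rewrite integral_mkcond; apply: eq_integral => y _.
  by rewrite patchE indicE; case: ifPn; rewrite ?mul1r ?mul0r.
apply: (measurable_integral_r (f := fun x y => (\1_B y * f x y)%:E)).
  apply/measurable_EFinP; apply: measurable_funM => //.
  by apply: (@measurableT_comp _ _ _ _ _ _ (\1_B : T2 -> R) setT snd).
by move=> x y; rewrite lee_fin mulr_ge0.
Qed.

End tonelli.

Lemma ge0_integralZ_EFin (R : realType) d (T : measurableType d)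
    (m : {measure set T -> \bar R}) (D : set T) (k : R) (f : T -> R) :
  measurable D -> measurable_fun D f -> (forall x, D x -> 0 <= f x) -> 0 <= k ->
  (\int[m]_(x in D) (k * f x)%:E = k%:E * \int[m]_(x in D) (f x)%:E)%E.
Proof.
move=> mD mf f0 k0; under eq_integral do rewrite EFinM.
by rewrite ge0_integralZl//; [exact/measurable_EFinP].
Qed.

Section avg_abs.
Context (R : realType).
Implicit Types r s u x : R.

(* [r * E|s + U|] for [U] uniform on [[-r, r]], that is [(1/2) \int_(-r)^r |s + u| du]. *)
Definition avg_abs r s : R := ((r + s) * `|r + s| + (r - s) * `|r - s|) / 4.

Lemma avg_absN r s : avg_abs r (- s) = avg_abs r s.
Proof. by rewrite /avg_abs opprK addrC. Qed.

(** Together with [avg_abs_ge] this identifies [avg_abs r], for r >= 0, as Huber's function plus r^2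
    / 2: quadratic on [-r, r], linear beyond. *)
Lemma avg_abs_le r s : `|s| <= r -> avg_abs r s = (r ^+ 2 + s ^+ 2) / 2.
Proof.
rewrite ler_norml => /andP[h1 h2].
rewrite /avg_abs !ger0_norm; [by field|lra|lra].
Qed.

Lemma avg_abs_ge r s : 0 <= r -> r <= `|s| -> avg_abs r s = r * `|s|.
Proof.
wlog s0 : s / 0 <= s.
  move=> h r0 rs; have [/h|/ltW s0] := leP 0 s; first exact.
  by rewrite -avg_absN -[in RHS]normrN h ?normrN ?oppr_ge0.
move=> r0; rewrite (ger0_norm s0) => rs.
rewrite /avg_abs ger0_norm; last by lra.
by rewrite ler0_norm; [field|lra].
Qed.

Lemma avg_abs_lb r s : 0 <= r -> r * `|s| <= avg_abs r s.
Proof.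
move=> r0; have [sr|/ltW rs] := leP `|s| r; last by rewrite avg_abs_ge.
rewrite avg_abs_le// -(real_normK (num_real s)).
by have := sqr_ge0 (r - `|s|); nra.
Qed.

Lemma avg_abs_ub r s : 0 <= r -> avg_abs r s <= r * `|s| + r ^+ 2 / 2.
Proof.
move=> r0; have [sr|/ltW rs] := leP `|s| r; last first.
  by rewrite avg_abs_ge// lerDl divr_ge0// sqr_ge0.
rewrite avg_abs_le// -(real_normK (num_real s)).
by have := normr_ge0 s; nra.
Qed.

Lemma avg_abs_ub2 r s : 0 <= r -> avg_abs r s <= (r ^+ 2 + s ^+ 2) / 2.
Proof.
move=> r0; have [sr|/ltW rs] := leP `|s| r; first by rewrite avg_abs_le.
rewrite avg_abs_ge// -(real_normK (num_real s)).
by have := sqr_ge0 (r - `|s|); nra.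
Qed.

Lemma avg_abs_ge0 r s : 0 <= r -> 0 <= avg_abs r s.
Proof. by move=> r0; rewrite (le_trans _ (avg_abs_lb s r0))// mulr_ge0. Qed.

Lemma measurable_avg_abs d (T : measurableType d) (f g : T -> R) :
  measurable_fun setT f -> measurable_fun setT g ->
  measurable_fun setT (fun t => avg_abs (f t) (g t)).
Proof.
move=> mf mg; apply: measurable_funM => //; apply: measurable_funD.
  have h : measurable_fun setT (f \+ g) by exact: measurable_funD.
  by apply: measurable_funM => //; exact: measurableT_comp.
have h : measurable_fun setT (f \- g) by exact: measurable_funB.
by apply: measurable_funM => //; exact: measurableT_comp.
Qed.

(** [avg_abs] is a combination of terms y |y|, whose primitive is |y|^3 / 3; cubes of absolute
    values therefore integrate it without splitting the domain. *)
Lemma is_derive_norm3 x :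
  is_derive x (1 : R) (fun y : R => `|y| ^+ 3 : R) (3 * x * `|x|).
Proof.
have D : is_derive x (1 : R) (fun y : R => y ^+ 3 : R) (3 * x ^+ 2).
  have := is_deriveX 3 (is_derive_id x (1 : R)).
  by rewrite exprfctE /GRing.scale/= mulr1.
have [x0|x0|<-] := ltgtP 0 x.
- rewrite (_ : 3 * x * `|x| = 3 * x ^+ 2); last by rewrite gtr0_norm//; ring.
  apply: near_eq_is_derive D.
  by near=> y; rewrite gtr0_norm//; near: y; exact: lt_nbhsr.
- rewrite (_ : 3 * x * `|x| = - (3 * x ^+ 2)); last by rewrite ltr0_norm//; ring.
  apply: near_eq_is_derive (is_deriveN D).
  near=> y; rewrite fctE ltr0_norm; first by rewrite exprNn -signr_odd expr1 mulN1r.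
  by near: y; exact: lt_nbhsl.
- rewrite mulr0 mul0r; apply/is_derive1_caratheodory.
  (* At 0 the difference quotient of |y|^3 is y |y|, continuous with value 0. *)
  exists (fun y => y * `|y|); split; last by rewrite mul0r.
    by move=> y; rewrite normr0 expr0n subr0 subr0 mulrAC -expr2 -(real_normK (num_real y)) -exprSr.
  by apply: cvgM => //; exact: norm_continuous.
Unshelve. all: end_near. Qed.

End avg_abs.

(** * Convolution with symmetric unimodal densities *)

Section smoothing.
Context (R : realType).
Implicit Types (r s u x z a h : R).
Local Notation mu := (@lebesgue_measure R).

Lemma measurable_ltr_natr d (T : measurableType d) (f g : T -> R) :
  measurable_fun setT f -> measurable_fun setT g ->
  measurable_fun setT (fun t => (f t < g t)%R%:R : R).
Proof.
move=> mf mg.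
rewrite (_ : (fun _ => _) = (fun t => if f t < g t then 1 else 0 : R)); last first.
  by apply/funext => t; case: ifP.
by apply: measurable_fun_ifT => //; exact: measurable_fun_ltr.
Qed.

Lemma layer_cake a : 0 <= a ->
  (\int[mu]_(h in `[0%R, +oo[) ((h < a)%R%:R)%:E = a%:E)%E.
Proof.
move=> a0.
under eq_integral.
  move=> h _.
  rewrite (_ : (h < a)%R%:R = \1_(`]-oo, a[%classic : set R) h); last first.
    by rewrite indicE mem_setE in_itv.
  over.
rewrite integral_indic// setIC.
rewrite (_ : `[0, +oo[ `&` `]-oo, a[ = `[0, a[%classic); last first.
  by apply/seteqP; split => x /=; rewrite !in_itv/= ?andbT => /andP.
apply: etrans (lebesgue_measure_itv _) _.
rewrite /= lte_fin; case: ltP => [_|ale]; first by rewrite -EFinB subr0.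
by congr EFin; apply/eqP; rewrite eq_le a0.
Qed.

(** The density is known only through the values of [nu] on sets. Layer cake turns the integral of g
    into values of [nu] on the superlevel sets of g, where the density can be inserted, and Tonelli
    reassembles g. *)
Lemma ge0_integral_density (nu : {sigma_finite_measure set R -> \bar R}) (f g : R -> R) :
  measurable_fun setT f -> (forall x, 0 <= f x) ->
  (forall A, measurable A -> nu A = \int[mu]_(x in A) (f x)%:E)%E ->
  measurable_fun setT g -> (forall x, 0 <= g x) ->
  (\int[nu]_x (g x)%:E = \int[mu]_x (g x * f x)%:E)%E.
Proof.
move=> mf f0 nuE mg g0.
have mI : measurable_fun setT (fun p : R * R => ((p.2 < g p.1)%R%:R)%:E : \bar R).
  apply/measurable_EFinP; apply: measurable_ltr_natr => //.
  exact: measurableT_comp.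
have mIf : measurable_fun setT (fun p : R * R => ((p.2 < g p.1)%R%:R * f p.1)%:E : \bar R).
  apply/measurable_EFinP; apply: measurable_funM; first exact/measurable_EFinP.
  exact: measurableT_comp.
transitivity (\int[nu]_x \int[mu]_(h in `[0%R, +oo[) ((h < g x)%R%:R)%:E)%E.
  by apply: eq_integral => x _; rewrite layer_cake.
rewrite (@tonelliD _ _ _ _ _ nu mu setT `[0%R, +oo[%classic (fun x h => ((h < g x)%R%:R)%:E))//.
transitivity (\int[mu]_(h in `[0%R, +oo[) \int[mu]_x ((h < g x)%R%:R * f x)%:E)%E.
  apply: eq_integral => h _.
  have mD : measurable [set x | h < g x].
    rewrite -[X in measurable X]setTI.
    rewrite (_ : [set x | _] = g @^-1` `]h, +oo[); first exact: mg.
    by apply/seteqP; split => x /=; rewrite in_itv/= andbT.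
  transitivity (\int[nu]_x (\1_[set x | h < g x] x)%:E)%E.
    apply: eq_integral => x _; rewrite indicE.
    by have -> : (x \in [set x | h < g x]) = (h < g x) by apply/idP/idP; rewrite inE.
  transitivity (nu [set x | h < g x]); first by rewrite integral_indic// setIT.
  rewrite nuE// integral_mkcond; apply: eq_integral => x _.
  rewrite patchE; case: ifPn; first by rewrite inE/= => ->; rewrite mul1r.
  by rewrite notin_setE/= => /negP/negbTE ->; rewrite mul0r.
rewrite -(@tonelliD _ _ _ _ _ mu mu setT `[0%R, +oo[%classic (fun x h => ((h < g x)%R%:R * f x)%:E))//; last first.
  by move=> x y; rewrite lee_fin mulr_ge0.
apply: eq_integral => x _.
under eq_integral do rewrite EFinM muleC.
rewrite ge0_integralZl//=.
- by rewrite layer_cake// -EFinM mulrC.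
- apply/measurable_EFinP/measurable_funTS; exact: measurable_ltr_natr.
- by rewrite lee_fin.
Qed.

Lemma is_derive_norm3_affine k c x :
  is_derive x (1 : R) (fun y : R => `|k * y + c| ^+ 3 : R)
    (3 * k * (k * x + c) * `|k * x + c|).
Proof.
have D1 : is_derive x (1 : R) (fun y : R => k * y + c : R) k.
  have := is_deriveD (is_deriveZ k (is_derive_id x (1 : R))) (is_derive_cst c x (1 : R)).
  by rewrite addr0 /GRing.scale/= mulr1.
have := @is_derive1_comp _ (fun y : R => `|y| ^+ 3) (fun y : R => k * y + c) x _ _
  (is_derive_norm3 _) D1.
by rewrite /comp/= => h; apply: is_derive_eq h _; rewrite /GRing.scale/=; ring.
Qed.

Lemma is_derive_norm3_comb k c k' c' e x :
  is_derive x (1 : R) (fun y : R => (`|k * y + c| ^+ 3 + e * `|k' * y + c'| ^+ 3) / 12 : R)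
   ((k * (k * x + c) * `|k * x + c| + e * (k' * (k' * x + c') * `|k' * x + c'|)) / 4).
Proof.
have h := is_deriveZ (12^-1) (is_deriveD (is_derive_norm3_affine k c x)
  (is_deriveZ e (is_derive_norm3_affine k' c' x))).
rewrite (_ : (fun y : R => _) = (12^-1 \*: ((fun y : R => `|k * y + c| ^+ 3 : R) +
   (e \*: (fun y : R => `|k' * y + c'| ^+ 3 : R))))); last first.
  by apply/funext => y; rewrite !fctE /GRing.scale/= mulrC.
by apply: is_derive_eq h _; rewrite /GRing.scale/=; field.
Qed.

Lemma continuous_avg_abs (f g : R -> R) : continuous f -> continuous g ->
  continuous (fun x => avg_abs (f x) (g x)).
Proof.
move=> cf cg x; apply: cvgM; last exact: cvg_cst.
apply: cvgD.
  apply: cvgM; first by apply: cvgD; [exact: cf|exact: cg].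
  by apply: cvg_norm; apply: cvgD; [exact: cf|exact: cg].
apply: cvgM; first by apply: cvgB; [exact: cf|exact: cg].
by apply: cvg_norm; apply: cvgB; [exact: cf|exact: cg].
Qed.

Lemma integral_FTC2 (F f : R -> R) a b : a <= b ->
  (forall x, is_derive x (1 : R) F (f x)) -> continuous f ->
  (\int[mu]_(x in `[a, b]) (f x)%:E = (F b - F a)%:E)%E.
Proof.
rewrite le_eqVlt => /predU1P[<- _ _|ab dF cf].
  by rewrite set_itv1 integral_set1 subrr.
have cF : continuous F.
  by move=> x; apply/differentiable_continuous/derivable1_diffP; case: (dF x).
rewrite (continuous_FTC2 (F := F) ab)//.
- exact: continuous_subspaceT.
- split; first by move=> x _; case: (dF x).
  + exact/cvg_at_right_filter/cF.
  + exact/cvg_at_left_filter/cF.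
- by move=> x _; rewrite derive1E; case: (dF x).
Qed.

(* The sum of two symmetric uniform variables is a mixture of symmetric uniform variables. *)
Lemma integral_avg_abs_itv r u s : 0 <= r -> 0 <= u ->
  (\int[mu]_(x in `[(- u)%R, u]) (avg_abs r (s + x))%:E =
   \int[mu]_(z in `[(`|r - u|)%R, (r + u)%R]) (avg_abs z s)%:E)%E.
Proof.
move=> r0 u0.
have E1 x : x + (r + s) = r + (s + x) by ring.
have E2 x : - x + (r - s) = r - (s + x) by ring.
have D1 x : is_derive x (1 : R)
    (fun y : R => (`|1 * y + (r + s)| ^+ 3 + -1 * `|-1 * y + (r - s)| ^+ 3) / 12 : R)
    (avg_abs r (s + x)).
  apply: is_derive_eq (is_derive_norm3_comb _ _ _ _ _ _) _.
  by rewrite /avg_abs !mul1r !mulN1r mulNr opprK E1 E2.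
have D2 x : is_derive x (1 : R)
    (fun y : R => (`|1 * y + s| ^+ 3 + 1 * `|1 * y + (- s)| ^+ 3) / 12 : R)
    (avg_abs x s).
  apply: is_derive_eq (is_derive_norm3_comb _ _ _ _ _ _) _.
  by rewrite /avg_abs !mul1r.
rewrite (integral_FTC2 _ D1); first last.
- by apply: continuous_avg_abs => x; [exact: cvg_cst|apply: cvgD; [exact: cvg_cst|exact: cvg_id]].
- by lra.
rewrite (integral_FTC2 _ D2); first last.
- by apply: continuous_avg_abs => x; [exact: cvg_id|exact: cvg_cst].
- by rewrite ler_norml; lra.
congr EFin; rewrite !mul1r !mulN1r opprK.
rewrite (_ : u + (r + s) = r + u + s); last ring.
rewrite -(normrN (- u + (r - s))) (_ : - (- u + (r - s)) = - (r - u) + s); last ring.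
rewrite (_ : - u + (r + s) = r - u + s); last ring.
rewrite (_ : u + (r - s) = r + u - s); last ring.
have EN d : `|- d + s| = `|d - s| by rewrite -normrN opprD opprK.
have EN' d : `|- d - s| = `|d + s| by rewrite -normrN opprD !opprK.
(* Both sides now consist of the same four cubes; only the sign hidden in |r - u| remains to be
   resolved. *)
rewrite EN; have [ru|ru] := ger0P (r - u); first by ring.
by rewrite EN EN'; ring.
Qed.

(* The superlevel sets of a symmetric unimodal density are, up to endpoints, intervals
   centred at [0]. *)
Lemma ae_symmetric_superlevel (f : R -> R) h : 0 < h ->
  measurable_fun setT f -> (forall x, 0 <= f x) -> (forall x, f (- x) = f x) ->
  (forall x y, 0 < x -> x < y -> f y <= f x) ->
  (\int[mu]_x (f x)%:E < +oo)%E ->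
  exists2 u, 0 <= u & forall g : R -> R, measurable_fun setT g -> (forall x, 0 <= g x) ->
  (\int[mu]_x (g x * (h < f x)%R%:R)%:E = \int[mu]_(x in `[(- u)%R, u]) (g x)%:E)%E.
Proof.
move=> h0 mf f0 fN fni fi.
pose S := [set x | 0 < x /\ h < f x].
(* An unbounded superlevel set would, by monotonicity, force f > h on the whole positive half-line
   and contradict integrability. *)
have ubS : has_ubound S.
  apply: contrapT => nub.
  have fh x : 0 < x -> h < f x.
    move=> x0; apply: contrapT => /negP; rewrite -leNgt => fxh.
    apply: nub; exists x => y [y0 hy]; rewrite leNgt; apply/negP => xy.
    by have := fni _ _ x0 xy; lra.
  move: fi; rewrite ltNge => /negP; apply.
  apply: (@le_trans _ _ (\int[mu]_(x in `]0%R, +oo[) h%:E)%E).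
    rewrite integral_cst//= lebesgue_measure_itv/= ltry//.
    by rewrite oppr0 adde0 gt0_muley// lte_fin.
  rewrite [leLHS]integral_mkcond; apply: ge0_le_integral => //.
  - by move=> x _; rewrite patchE; case: ifPn => // _; rewrite lee_fin ltW.
  - by apply/(measurable_restrictT _ _).1.
  - exact/measurable_EFinP.
  - move=> x _; rewrite patchE; case: ifPn => [|_]; last by rewrite lee_fin.
    by rewrite inE/= in_itv/= andbT => /fh /ltW; rewrite lee_fin.
have [u u0 uP] : exists2 u, 0 <= u & forall x, 0 < x -> (x < u -> h < f x) /\ (u < x -> f x <= h).
  have [S0|S0] := pselect (S !=set0).
    exists (sup S).
      by have [x Sx] := S0; apply: le_trans (ub_le_sup ubS Sx); exact/ltW/Sx.1.
    move=> x x0; split => xs.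
      have [y [y0 hy] xy] := sup_gt S0 xs.
      exact: lt_le_trans (fni _ _ x0 xy).
    rewrite leNgt; apply/negP => hx.
    by have := ub_le_sup ubS (conj x0 hx); rewrite leNgt xs.
  exists 0 => // x x0; split; first by lra.
  by move=> _; rewrite leNgt; apply/negP => hx; apply: S0; exists x.
exists u => // g mg g0.
rewrite [RHS]integral_mkcond; apply: ge0_ae_eq_integral => //.
- apply/measurable_EFinP/measurable_funM => //; exact: measurable_ltr_natr.
- by apply/(measurable_restrictT _ _).1 => //; apply/measurable_funTS/measurable_EFinP.
- by move=> x _; rewrite lee_fin mulr_ge0.
- by move=> x _; rewrite patchE; case: ifPn => // _; rewrite lee_fin.
(* The value of f at 0 is arbitrary and the superlevel set may or may not contain u and -u;
   everywhere else it agrees with the interval. *)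
exists ([set 0] `|` [set u] `|` [set - u]); split.
- by apply: measurableU => //; exact: measurableU.
- apply: countable_lebesgue_measure0; apply: finite_set_countable.
  by rewrite !finite_setU; split => //; split.
move=> x /=; apply: contra_notP => /not_orP[/not_orP[x0 xu] xNu] _.
have fx : f x = f `|x| by case: (ger0P x) => // _; rewrite fN.
have nx0 : 0 < `|x| by rewrite normr_gt0; exact/eqP.
rewrite patchE mem_setE in_itv/= -ler_norml.
have [xu'|ux|xu'] := ltgtP `|x| u.
- by rewrite fx (uP _ nx0).1// mulr1.
- by rewrite fx ltNge (uP _ nx0).2// mulr0.
- by exfalso; move: xu'; case: (ger0P x) => _ h1; [exact: xu|apply: xNu; rewrite -h1 opprK].
Qed.

(** Slicing f by heights turns it into indicators of centred intervals, and [avg_abs r] integrated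
    along such an interval is an integral of functions [avg_abs z] with z >= 0. So even a single r
    in the conclusion calls on the hypothesis for a whole range of parameters. *)
Lemma le_integral_avg_abs_conv (m1 m2 : {sigma_finite_measure set R -> \bar R}) (f : R -> R) :
  measurable_fun setT f -> (forall x, 0 <= f x) -> (forall x, f (- x) = f x) ->
  (forall x y, 0 < x -> x < y -> f y <= f x) ->
  (\int[mu]_x (f x)%:E < +oo)%E ->
  (forall r, (0 <= r)%R -> \int[m1]_s (avg_abs r s)%:E <= \int[m2]_s (avg_abs r s)%:E)%E ->
  (forall r, (0 <= r)%R -> \int[m1]_s \int[mu]_x (avg_abs r (s + x) * f x)%:E <=
     \int[m2]_s \int[mu]_x (avg_abs r (s + x) * f x)%:E)%E.
Proof.
move=> mf f0 fN fni fi m12 r r0.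
have A0 s : 0 <= avg_abs r s by exact: avg_abs_ge0.
pose G s h : \bar R := (\int[mu]_x (avg_abs r (s + x) * (h < f x)%R%:R)%:E)%E.
have mA d (T : measurableType d) (a b : T -> R) : measurable_fun setT a -> measurable_fun setT b ->
    measurable_fun setT (fun t => avg_abs r (a t + b t)).
  by move=> ma mb; apply: measurable_avg_abs => //; exact: measurable_funD.
have mG : measurable_fun setT (fun p : R * R => G p.1 p.2).
  pose g (q : (R * R) * R) : \bar R := (avg_abs r (q.1.1 + q.2) * (q.1.2 < f q.2)%R%:R)%:E.
  have mg : measurable_fun setT g.
    apply/measurable_EFinP/measurable_funM; first by apply: mA => //; exact: measurableT_comp.
    by apply: measurable_ltr_natr; exact: measurableT_comp.
  have g0 q : (0 <= g q)%E by rewrite lee_fin mulr_ge0.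
  have := @measurable_fun_fubini_tonelli_F _ _ _ _ _ mu g mg g0.
  by rewrite /fubini_F; apply: eq_measurable_fun => -[].
have G0 s h : (0 <= G s h)%E by apply: integral_ge0 => x _; rewrite lee_fin mulr_ge0.
have key (m : {sigma_finite_measure set R -> \bar R}) :
    (\int[m]_s \int[mu]_x (avg_abs r (s + x) * f x)%:E =
     \int[mu]_(h in `[0%R, +oo[) \int[m]_s G s h)%E.
  rewrite -(@tonelliD _ _ _ _ _ m mu setT `[0%R, +oo[%classic G)//.
  apply: eq_integral => s _.
  transitivity (\int[mu]_x \int[mu]_(h in `[0%R, +oo[) (avg_abs r (s + x) * (h < f x)%R%:R)%:E)%E.
    apply: eq_integral => x _; under [RHS]eq_integral do rewrite EFinM.
    rewrite ge0_integralZl//= ?lee_fin//; first by rewrite layer_cake// EFinM.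
    by apply/measurable_EFinP/measurable_funTS; exact: measurable_ltr_natr.
  rewrite (@tonelliD _ _ _ _ _ mu mu setT `[0%R, +oo[%classic
    (fun x h => (avg_abs r (s + x) * (h < f x)%R%:R)%:E))//.
  - apply/measurable_EFinP/measurable_funM; first exact: mA.
    by apply: measurable_ltr_natr => //; exact: measurableT_comp.
  - by move=> x h; rewrite lee_fin mulr_ge0.
rewrite !key.
have mGm (m : {sigma_finite_measure set R -> \bar R}) :
    measurable_fun setT (fun h => \int[m]_s G s h)%E.
  exact: (measurable_integral_l m mG G0).
(* Height 0 is discarded as a null set: the superlevel set there may be unbounded. *)
rewrite -!(integral_itv_obnd_cbnd _); try exact: measurable_funTS.
apply: ge0_le_integral => //.
- by move=> h _; apply: integral_ge0.
- by apply: measurable_funTS; exact: mGm.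
- by apply: measurable_funTS; exact: mGm.
move=> h /=; rewrite in_itv/= andbT => h0.
have [u u0 uP] := ae_symmetric_superlevel h0 mf f0 fN fni fi.
(* [avg_abs z s] can be negative for z < 0; the absolute value of z makes Tonelli applicable and is
   invisible on the interval. *)
have GE (m : {sigma_finite_measure set R -> \bar R}) : (\int[m]_s G s h =
    \int[mu]_(z in `[(`|r - u|)%R, (r + u)%R]) \int[m]_s (avg_abs `|z| s)%:E)%E.
  transitivity (\int[m]_s \int[mu]_(z in `[(`|r - u|)%R, (r + u)%R]) (avg_abs `|z| s)%:E)%E.
    apply: eq_integral => s _; rewrite /G uP//; last by apply: mA.
    rewrite integral_avg_abs_itv//; apply: eq_integral => z.
    by rewrite inE/= in_itv/= => /andP[/(le_trans (normr_ge0 _)) z0 _]; rewrite ger0_norm.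
  rewrite (@tonelliD _ _ _ _ _ m mu setT _ (fun s z => (avg_abs `|z| s)%:E))//.
  - apply/measurable_EFinP/measurable_avg_abs => //; exact: measurableT_comp.
  - by move=> *; rewrite lee_fin avg_abs_ge0.
have mGA (m : {sigma_finite_measure set R -> \bar R}) :
    measurable_fun setT (fun z : R => \int[m]_s (avg_abs `|z| s)%:E)%E.
  apply: (measurable_integral_l m (f := fun s z : R => (avg_abs `|z| s)%:E)).
    apply/measurable_EFinP/measurable_avg_abs => //; exact: measurableT_comp.
  by move=> *; rewrite lee_fin avg_abs_ge0.
rewrite !GE; apply: ge0_le_integral => //.
- by move=> z _; apply: integral_ge0 => s _; rewrite lee_fin avg_abs_ge0.
- by apply: measurable_funTS; exact: mGA.
- by apply: measurable_funTS; exact: mGA.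
- by move=> z _; apply: m12.
Qed.

End smoothing.

(** * Centred Gaussian laws *)

Section gauss.
Context (R : realType).
Implicit Types (r s u x y z v w : R).
Local Notation mu := (@lebesgue_measure R).

(** The parameter is the variance, so that convolution adds parameters. *)
Definition gauss_pdf v x : R := normal_pdf 0 (Num.sqrt v) x.

Lemma gauss_pdfE v x : 0 < v ->
  gauss_pdf v x = (Num.sqrt (2 * pi * v))^-1 * expR (- (x ^+ 2 / (2 * v))).
Proof.
move=> v0; rewrite /gauss_pdf normal_pdfE; last by rewrite gt_eqF// sqrtr_gt0.
rewrite /normal_peak /normal_fun sqr_sqrtr ?ltW// subr0.
congr (_^-1 * expR _); first by congr Num.sqrt; rewrite -mulr_natr; ring.
by rewrite -mulr_natl mulNr.
Qed.

Lemma gauss_pdf_ge0 v x : 0 <= gauss_pdf v x.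
Proof. exact: normal_pdf_ge0. Qed.

Lemma gauss_pdfN v x : 0 < v -> gauss_pdf v (- x) = gauss_pdf v x.
Proof. by move=> v0; rewrite !gauss_pdfE// sqrrN. Qed.

Lemma measurable_gauss_pdf v : measurable_fun setT (gauss_pdf v).
Proof. exact: measurable_normal_pdf. Qed.

Lemma continuous_gauss_pdf v : 0 < v -> continuous (gauss_pdf v).
Proof. by move=> v0; apply: continuous_normal_pdf; rewrite gt_eqF// sqrtr_gt0. Qed.

Lemma gauss_pdf_le v x y : 0 < v -> 0 < x -> x < y -> gauss_pdf v y <= gauss_pdf v x.
Proof.
move=> v0 x0 xy; rewrite !gauss_pdfE// ler_wpM2l ?invr_ge0//.
rewrite ler_expR lerN2 ler_pM2r ?invr_gt0 ?mulr_gt0//.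
by rewrite ler_sqr ?nnegrE ?ltW// (lt_trans x0).
Qed.

Lemma gauss_pdf_le_peak v x : 0 < v -> gauss_pdf v x <= (Num.sqrt (2 * pi * v))^-1.
Proof.
move=> v0; rewrite gauss_pdfE// ler_piMr ?invr_ge0// -expR0 ler_expR oppr_le0.
by rewrite divr_ge0 ?sqr_ge0// mulr_ge0// ltW.
Qed.

Lemma integral_gauss_pdf v : (\int[mu]_x (gauss_pdf v x)%:E = 1)%E.
Proof. exact: integral_normal_pdf. Qed.

(** Completing the square: the joint density of x and of the sum z factors into the marginal density
    of z times the conditional density of x given z. *)
Lemma gauss_pdfM v w z x : 0 < v -> 0 < w ->
  gauss_pdf w (z - x) * gauss_pdf v x =
  gauss_pdf (v + w) z * normal_pdf (z * v / (v + w)) (Num.sqrt (v * w / (v + w))) x.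
Proof.
move=> v0 w0; have vw0 : 0 < v + w by rewrite addr_gt0.
have vwn : v + w != 0 by rewrite gt_eqF.
have q0 : 0 < v * w / (v + w) by rewrite divr_gt0// mulr_gt0.
rewrite !gauss_pdfE// normal_pdfE; last by rewrite gt_eqF// sqrtr_gt0.
rewrite /normal_peak /normal_fun sqr_sqrtr ?ltW//.
rewrite [LHS]mulrACA [RHS]mulrACA -!invfM -!expRD; congr (_^-1 * expR _).
  have p0 := pi_gt0 R; rewrite -!sqrtrM; last 2 first.
  - by rewrite !mulr_ge0// ltW.
  - by rewrite !mulr_ge0// ltW.
  congr Num.sqrt; rewrite -[_ *+ 2]mulr_natl; field.
  by rewrite vwn.
rewrite -[_ *+ 2]mulr_natl; field.
by rewrite !gt_eqF.
Qed.

Lemma ge0_integral_translation (f : R -> R) y : continuous f -> (forall x, 0 <= f x) ->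
  (\int[mu]_x (f (y + x))%:E = \int[mu]_x (f x)%:E)%E.
Proof.
move=> cf f0.
have D x : is_derive x (1 : R) (fun x : R => y + x : R) 1.
  by have := is_deriveD (is_derive_cst y x (1 : R)) (is_derive_id x (1 : R)); rewrite add0r.
have DE : derive1 (fun x : R => y + x : R) = cst 1.
  by apply/funext => x; rewrite derive1E; case: (D x).
rewrite [RHS](@increasing_ge0_integration_by_substitutionT _ (fun x => y + x))//.
- by apply: eq_integral => x _; rewrite DE !fctE mulr1.
- by move=> a b ab; rewrite ltrD2l.
- by rewrite DE => x; exact: cvg_cst.
- by rewrite DE; exact: is_cvg_cst.
- by rewrite DE; exact: is_cvg_cst.
- exact: cvg_addrl_Ny.
- exact: cvg_addrl.
Qed.

Lemma integral_avg_abs_gauss_conv r v w : 0 <= r -> 0 < v -> 0 < w ->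
  (\int[mu]_x \int[mu]_s (avg_abs r (x + s) * gauss_pdf w s * gauss_pdf v x)%:E =
   \int[mu]_z (avg_abs r z * gauss_pdf (v + w) z)%:E)%E.
Proof.
move=> r0 v0 w0.
have mgp d (T : measurableType d) (f : T -> R) p : measurable_fun setT f ->
    measurable_fun setT (fun t => gauss_pdf p (f t)).
  by move=> mf; apply: measurableT_comp => //; exact: measurable_gauss_pdf.
transitivity (\int[mu]_x \int[mu]_z (avg_abs r z * gauss_pdf w (z - x) * gauss_pdf v x)%:E)%E.
  apply: eq_integral => x _.
  rewrite -(@ge0_integral_translation (fun z => avg_abs r z * gauss_pdf w (z - x) * gauss_pdf v x) x).
  - by apply: eq_integral => s _; rewrite [x + s - x]addrAC subrr add0r.
  - move=> z; apply: cvgM; last exact: cvg_cst.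
    apply: cvgM; first by apply: continuous_avg_abs => t; [exact: cvg_cst|exact: cvg_id].
    apply: (@continuous_comp _ _ _ (fun z => z - x) (gauss_pdf w)); last exact: continuous_gauss_pdf.
    by apply: cvgB; [exact: cvg_id|exact: cvg_cst].
  - by move=> z; apply: mulr_ge0 (gauss_pdf_ge0 _ _); apply: mulr_ge0 (gauss_pdf_ge0 _ _); exact: avg_abs_ge0.
rewrite (@tonelliD _ _ _ _ _ mu mu setT setT
  (fun x z => (avg_abs r z * gauss_pdf w (z - x) * gauss_pdf v x)%:E))//; first last.
- move=> x z; rewrite lee_fin; apply: mulr_ge0 (gauss_pdf_ge0 _ _).
  by apply: mulr_ge0 (gauss_pdf_ge0 _ _); exact: avg_abs_ge0.
- apply/measurable_EFinP; apply: measurable_funM; last exact: mgp.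
  by apply: measurable_funM; [exact: measurable_avg_abs|apply: mgp; exact: measurable_funB].
apply: eq_integral => z _.
under eq_integral do rewrite -mulrA gauss_pdfM// mulrA.
rewrite ge0_integralZ_EFin//=.
- by rewrite integral_normal_pdf mule1.
- exact: measurable_normal_pdf.
- by move=> x _; rewrite normal_pdf_ge0.
- by rewrite mulr_ge0 ?gauss_pdf_ge0 ?avg_abs_ge0.
Qed.

Lemma integral_xexp v y : 0 < v -> 0 <= y ->
  (\int[mu]_(x in `[y, +oo[) (x * expR (- (x ^+ 2 / (2 * v))))%:E =
   (v * expR (- (y ^+ 2 / (2 * v))))%:E)%E.
Proof.
move=> v0 y0.
pose F x : R := - v * expR (- (x ^+ 2 / (2 * v))).
have D x : is_derive x (1 : R) F (x * expR (- (x ^+ 2 / (2 * v)))).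
  have D1 : is_derive x (1 : R) (fun x : R => - (x ^+ 2 / (2 * v)) : R) (- (x / v)).
    have h := is_deriveN (is_deriveZ (2 * v)^-1 (is_deriveX 2 (is_derive_id x (1 : R)))).
    rewrite (_ : (fun x : R => _) = - ((2 * v)^-1 \*: ((id : R -> R) ^+ 2))); last first.
      by apply/funext => t; rewrite !fctE /GRing.scale/= mulrC.
    by apply: is_derive_eq h _; rewrite /GRing.scale/=; field; rewrite gt_eqF.
  have D2 := @is_derive1_comp _ expR _ x _ _ (is_derive_expR _) D1.
  have D3 := is_deriveZ (- v) D2.
  by apply: is_derive_eq D3 _; rewrite /GRing.scale/=; field; rewrite gt_eqF.
have cF : continuous F.
  by move=> x; apply/differentiable_continuous/derivable1_diffP; case: (D x).
have cf : continuous (fun x : R => x * expR (- (x ^+ 2 / (2 * v)))).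
  move=> x; apply: cvgM; first exact: cvg_id.
  apply: (@continuous_comp _ _ _ (fun x : R => - (x ^+ 2 / (2 * v))) expR); last exact: continuous_expR.
  by apply: cvgN; apply: cvgM; [exact: sqr_continuous|exact: cvg_cst].
rewrite (@ge0_continuous_FTC2y _ _ F y 0)//.
- by rewrite -EFinB sub0r /F mulNr opprK.
- by move=> x yx; rewrite mulr_ge0 ?expR_ge0// (le_trans y0).
- exact: continuous_subspaceT.
- rewrite -(mulr0 (- v)); apply: cvgM; first exact: cvg_cst.
  apply: (@cvg_comp _ _ _ (fun x : R => x ^+ 2 / (2 * v)) (fun x => expR (- x)) _ +oo%R); last exact: cvgr_expR.
  apply/gt0_cvgMly; last exact: cvgr_expr2.
  by rewrite invr_gt0 mulr_gt0.
- exact/cvg_at_right_filter/cF.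
- by move=> x _; rewrite derive1E; case: (D x).
Qed.

Lemma integral_even_gauss (f : R -> R) v : 0 < v -> continuous f -> (forall x, 0 <= f x) ->
  (forall x, f (- x) = f x) ->
  (\int[mu]_x (f x * gauss_pdf v x)%:E =
   (2 / Num.sqrt (2 * pi * v))%:E * \int[mu]_(x in `[0%R, +oo[) (f x * expR (- (x ^+ 2 / (2 * v))))%:E)%E.
Proof.
move=> v0 cf f0 fN.
rewrite ge0_symfun_integralT.
- rewrite -set_itvcy EFinM -muleA; congr (_ * _)%E.
  rewrite -ge0_integralZl//.
  + by apply: eq_integral => x _; rewrite -EFinM gauss_pdfE// mulrCA.
  + apply/measurable_EFinP/measurable_funTS/measurable_funM; first exact: continuous_measurable_fun.
    apply: measurableT_comp => //; apply: measurable_funN.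
    by apply: measurable_funM => //; exact: measurable_funX.
  + by move=> x _; rewrite lee_fin mulr_ge0 ?expR_ge0.
- by move=> x; rewrite mulr_ge0 ?gauss_pdf_ge0.
- by move=> x; apply: cvgM; [exact: cf|exact: continuous_gauss_pdf].
- by move=> x; rewrite /= fN gauss_pdfN.
Qed.

Lemma integral_norm_gauss v : 0 < v ->
  (\int[mu]_x (`|x| * gauss_pdf v x)%:E = (2 * v / Num.sqrt (2 * pi * v))%:E)%E.
Proof.
move=> v0; rewrite (@integral_even_gauss (fun x => `|x|))//; last 2 first.
- exact: norm_continuous.
- exact: normrN.
under eq_integral.
  move=> x; rewrite inE/= in_itv/= andbT => x0; rewrite ger0_norm//; over.
by rewrite integral_xexp// expr0n/= mul0r oppr0 expR0 mulr1 -EFinM mulrAC.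
Qed.

(** Integration by parts in the form of Tonelli: one factor x is the length of [0, x], and
    exchanging the integrals leaves the tail integral of [integral_xexp], hence v times the total
    mass. *)
Lemma integral_sqr_gauss v : 0 < v ->
  (\int[mu]_x (x ^+ 2 * gauss_pdf v x)%:E = v%:E)%E.
Proof.
move=> v0; rewrite (@integral_even_gauss (fun x => x ^+ 2))//; last 3 first.
- exact: sqr_continuous.
- by move=> x; exact: sqr_ge0.
- by move=> x; rewrite sqrrN.
pose e x : R := expR (- (x ^+ 2 / (2 * v))).
have me : measurable_fun setT e.
  apply: measurableT_comp => //; apply: measurable_funN.
  by apply: measurable_funM => //; exact: measurable_funX.
have e0 x : 0 <= e x by exact: expR_ge0.
transitivity ((2 / Num.sqrt (2 * pi * v))%:E *
  \int[mu]_(x in `[0%R, +oo[) \int[mu]_(y in `[0%R, +oo[) ((y < x)%R%:R * (`|x| * e x))%:E)%E.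
  congr (_ * _)%E; apply: eq_integral => x; rewrite inE/= in_itv/= andbT => x0.
  under [RHS]eq_integral do rewrite EFinM muleC.
  rewrite ge0_integralZl//=.
  - by rewrite layer_cake// -EFinM ger0_norm// mulrAC expr2 /e.
  - by apply/measurable_EFinP/measurable_funTS; exact: measurable_ltr_natr.
  - by rewrite lee_fin mulr_ge0.
rewrite (@tonelliD _ _ _ _ _ mu mu `[0%R, +oo[%classic `[0%R, +oo[%classic
   (fun x y => ((y < x)%R%:R * (`|x| * e x))%:E))//; first last.
- by move=> x y; rewrite lee_fin !mulr_ge0.
- apply/measurable_EFinP; apply: measurable_funM; first exact: measurable_ltr_natr.
  by apply: measurable_funM; exact: measurableT_comp.
transitivity ((2 / Num.sqrt (2 * pi * v))%:E * \int[mu]_(y in `[0%R, +oo[) (v%:E * (1 * e y)%:E))%E.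
  congr (_ * _)%E; apply: eq_integral => y; rewrite inE/= in_itv/= andbT => y0.
  rewrite mul1r -EFinM -integral_xexp// -integral_itv_obnd_cbnd; last first.
    apply/measurable_EFinP/measurable_funTS; apply: measurable_funM => //; exact: me.
  rewrite [LHS]integral_mkcond [RHS]integral_mkcond; apply: eq_integral => x _.
  rewrite !patchE !mem_setE !in_itv/= !andbT.
  case: ifPn => x0; last by rewrite ifN// -leNgt (le_trans _ y0)// ltW// ltNge.
  by case: ifPn => yx; rewrite ?mul0r// mul1r ger0_norm.
rewrite ge0_integralZl//; first last.
- by rewrite lee_fin ltW.
- by move=> y _; rewrite lee_fin mul1r.
- by apply/measurable_EFinP/measurable_funTS; under eq_fun do rewrite mul1r.
rewrite muleCA -(@integral_even_gauss (fun=> 1))//; last by move=> x; exact: cvg_cst.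
under eq_integral do rewrite mul1r.
by rewrite integral_gauss_pdf mule1.
Qed.

(** The quadratic formula valid on [-r, r] majorizes [avg_abs r] everywhere. The bound is good when
    r is large compared with the standard deviation; [integral_avg_abs_gauss_ub2] serves small r. *)
Lemma integral_avg_abs_gauss_ub1 v r : 0 < v -> 0 <= r ->
  (\int[mu]_x (avg_abs r x * gauss_pdf v x)%:E <= (r ^+ 2 / 2 + v / 2)%:E)%E.
Proof.
move=> v0 r0.
have mg := measurable_gauss_pdf v.
apply: (@le_trans _ _ (\int[mu]_x ((r ^+ 2 / 2 * gauss_pdf v x)%:E + (2^-1 * (x ^+ 2 * gauss_pdf v x))%:E))%E).
  apply: ge0_le_integral => //.
  - by move=> x _; rewrite lee_fin mulr_ge0 ?gauss_pdf_ge0 ?avg_abs_ge0.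
  - apply/measurable_EFinP/measurable_funM => //; exact: measurable_avg_abs.
  - apply: emeasurable_funD; apply/measurable_EFinP; first exact: measurable_funM.
    by apply: measurable_funM => //; apply: measurable_funM.
  - move=> x _; rewrite -EFinD lee_fin.
    rewrite (_ : _ + _ = (r ^+ 2 + x ^+ 2) / 2 * gauss_pdf v x); last by field.
    by rewrite ler_wpM2r ?gauss_pdf_ge0// avg_abs_ub2.
rewrite ge0_integralD//; last 4 first.
- by move=> x _; rewrite lee_fin mulr_ge0 ?gauss_pdf_ge0// divr_ge0 ?sqr_ge0.
- by apply/measurable_EFinP; exact: measurable_funM.
- by move=> x _; rewrite lee_fin; apply: mulr_ge0; rewrite ?invr_ge0// mulr_ge0 ?sqr_ge0 ?gauss_pdf_ge0.
- by apply/measurable_EFinP; apply: measurable_funM => //; apply: measurable_funM.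
rewrite !ge0_integralZ_EFin//; first last.
- by rewrite divr_ge0 ?sqr_ge0.
- by move=> x _; rewrite gauss_pdf_ge0.
- by move=> x _; rewrite mulr_ge0 ?sqr_ge0 ?gauss_pdf_ge0.
- by apply: measurable_funM.
by rewrite integral_gauss_pdf integral_sqr_gauss// mule1 -EFinM -EFinD [2^-1 * v]mulrC.
Qed.

(** The excess of [avg_abs r x] over r |x| is (r - |x|)^2 / 2 on [-r, r] and 0 beyond. Its Lebesgue
    integral is r^3 / 3, and the Gaussian density is bounded by its peak. *)
Lemma integral_avg_abs_gauss_ub2 v r : 0 < v -> 0 <= r ->
  (\int[mu]_x (avg_abs r x * gauss_pdf v x)%:E <=
   (r * (2 * v / Num.sqrt (2 * pi * v)) + r ^+ 3 / 3 / Num.sqrt (2 * pi * v))%:E)%E.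
Proof.
move=> v0 r0.
have mg := measurable_gauss_pdf v.
set k := (Num.sqrt (2 * pi * v))^-1.
have k0 : 0 <= k by rewrite invr_ge0.
pose q x : R := avg_abs r x - r * `|x|.
have q0 x : 0 <= q x by rewrite subr_ge0 avg_abs_lb.
have mq : measurable_fun setT q.
  by apply: measurable_funB; [exact: measurable_avg_abs|apply: measurable_funM => //; exact: measurableT_comp].
have cq : continuous q.
  move=> x; apply: cvgB; first by apply: continuous_avg_abs => y; [exact: cvg_cst|exact: cvg_id].
  by apply: cvgM; [exact: cvg_cst|exact: norm_continuous].
apply: (@le_trans _ _ (\int[mu]_x (r%:E * (`|x| * gauss_pdf v x)%:E + k%:E * (q x)%:E))%E).
  apply: ge0_le_integral => //.
  - by move=> x _; rewrite lee_fin mulr_ge0 ?gauss_pdf_ge0 ?avg_abs_ge0.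
  - apply/measurable_EFinP/measurable_funM => //; exact: measurable_avg_abs.
  - apply: emeasurable_funD; apply: emeasurable_funM => //; apply/measurable_EFinP => //.
    by apply: measurable_funM => //; exact: measurableT_comp.
  - move=> x _; rewrite -!EFinM -EFinD lee_fin mulrA -[avg_abs r x](subrK (r * `|x|)) -/(q x).
    by rewrite mulrDl addrC lerD2l mulrC ler_wpM2r// gauss_pdf_le_peak.
rewrite ge0_integralD//; last 4 first.
- by move=> x _; rewrite -EFinM lee_fin !mulr_ge0 ?gauss_pdf_ge0.
- apply: emeasurable_funM => //; apply/measurable_EFinP => //.
  by apply: measurable_funM => //; exact: measurableT_comp.
- by move=> x _; rewrite -EFinM lee_fin !mulr_ge0.
- by apply: emeasurable_funM => //; exact/measurable_EFinP.
rewrite ge0_integralZl//; first last.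
- by move=> x _; rewrite lee_fin mulr_ge0 ?gauss_pdf_ge0.
- apply/measurable_EFinP; apply: measurable_funM => //; exact: measurableT_comp.
rewrite ge0_integralZl//; first last.
- by move=> x _; rewrite lee_fin.
- exact/measurable_EFinP.
rewrite integral_norm_gauss// EFinD -EFinM; apply: leeD => //.
rewrite ge0_symfun_integralT//; last first.
  by move=> x; rewrite /q/= avg_absN normrN.
rewrite -set_itvcy.
rewrite (_ : \int[mu]_(x in `[0%R, +oo[) (q x)%:E = \int[mu]_(x in `[0%R, r]) ((r - x) ^+ 2 / 2)%:E)%E.
  have D x : is_derive x (1 : R) (fun x : R => - ((r - x) ^+ 3 / 6) : R) ((r - x) ^+ 2 / 2).
    have D1 : is_derive x (1 : R) (fun x : R => r - x : R) (- 1).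
      by have := is_deriveB (is_derive_cst r x (1 : R)) (is_derive_id x (1 : R)); rewrite sub0r.
    have h := is_deriveN (is_deriveZ 6^-1 (is_deriveX 3 D1)).
    rewrite (_ : (fun x : R => _) = - (6^-1 \*: ((fun x : R => r - x : R) ^+ 3))); last first.
      by apply/funext => t; rewrite !fctE /GRing.scale/= mulrC.
    by apply: is_derive_eq h _; rewrite /GRing.scale/=; field.
  rewrite (integral_FTC2 r0 D); last first.
    move=> x; apply: cvgM; last exact: cvg_cst.
    apply: (@continuous_comp _ _ _ (fun x : R => r - x) (fun x => x ^+ 2)); last exact: sqr_continuous.
    by apply: cvgB; [exact: cvg_cst|exact: cvg_id].
  rewrite subrr subr0 expr0n/= mul0r oppr0 add0r opprK -!EFinM lee_fin le_eqVlt; apply/orP; left.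
  by apply/eqP; field.
rewrite [LHS]integral_mkcond [RHS]integral_mkcond; apply: eq_integral => x _.
rewrite !patchE !mem_setE !in_itv/= andbT.
have [x0|x0] /= := leP 0 x => //.
have [xr|rx] /= := leP x r.
  by rewrite /q avg_abs_le ger0_norm//; congr EFin; field.
by rewrite /q avg_abs_ge ?subrr// ger0_norm// ltW.
Qed.

End gauss.

(** * Comparison of a logarithmic profile with the Gaussian *)

Section numeric.
Context (R : realType).
Implicit Types (r x y t l v : R).

Lemma is_derive_ge0_ge0 (f df : R -> R) x :
  (forall y, is_derive y (1 : R) f (df y)) -> 0 <= f 0 ->
  (forall y, 0 <= y -> 0 <= df y) -> 0 <= x -> 0 <= f x.
Proof.
move=> D f0 df0 x0.
have cf : continuous f.
  by move=> y; apply/differentiable_continuous/derivable1_diffP; case: (D y).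
have [c c0 fc] := @MVT_segment _ f df 0 x x0 (fun y _ => D y) (continuous_subspaceT cf).
rewrite -(subrK (f 0) (f x)) addr_ge0// fc subr0 mulr_ge0// df0//.
by move: c0; rewrite in_itv/= => /andP[].
Qed.

Lemma sin_le x : 0 <= x -> sin x <= x.
Proof.
move=> x0; rewrite -subr_ge0; move: x0.
apply: (@is_derive_ge0_ge0 (fun x => x - sin x) (fun x => 1 - cos x)).
- by rewrite sin0 subr0.
- by move=> y _; rewrite subr_ge0 cos_le1.
Qed.

Lemma cos_ge_quad x : 0 <= x -> 1 - x ^+ 2 / 2 <= cos x.
Proof.
move=> x0; suff : 0 <= cos x - 1 + x ^+ 2 / 2 by lra.
move: x0; apply: (@is_derive_ge0_ge0 (fun x => cos x - 1 + x ^+ 2 / 2) (fun x => x - sin x)).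
- move=> y.
  have h := is_deriveD (is_deriveB (is_derive_cos y) (is_derive_cst (1 : R) y (1 : R)))
    (is_deriveZ 2^-1 (is_deriveX 2 (is_derive_id y (1 : R)))).
  rewrite (_ : (fun x : R => _) = (cos - cst 1 + 2^-1 \*: ((id : R -> R) ^+ 2))); last first.
    by apply/funext => z; rewrite !fctE /GRing.scale/= [_ / 2]mulrC.
  by apply: is_derive_eq h _; rewrite /GRing.scale/=; field.
- by rewrite cos0; lra.
- by move=> y /sin_le; rewrite subr_ge0.
Qed.

Lemma sin_ge_cubic x : 0 <= x -> x - x ^+ 3 / 6 <= sin x.
Proof.
move=> x0; suff : 0 <= sin x - x + x ^+ 3 / 6 by lra.
move: x0; apply: (@is_derive_ge0_ge0 (fun x => sin x - x + x ^+ 3 / 6) (fun x => cos x - 1 + x ^+ 2 / 2)).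
- move=> y.
  have h := is_deriveD (is_deriveB (is_derive_sin y) (is_derive_id y (1 : R)))
    (is_deriveZ 6^-1 (is_deriveX 3 (is_derive_id y (1 : R)))).
  rewrite (_ : (fun x : R => _) = (sin - id + 6^-1 \*: ((id : R -> R) ^+ 3))); last first.
    by apply/funext => z; rewrite !fctE /GRing.scale/= [_ / 6]mulrC.
  by apply: is_derive_eq h _; rewrite /GRing.scale/=; field.
- by rewrite sin0; lra.
- by move=> y /cos_ge_quad; lra.
Qed.

(** At x = pi / 4 both cos and sin have square 1/2. If x were too small, 1 - x^2 / 2 would push cos
    x above 0.708 > 1 / sqrt 2; if too large, x - x^3 / 6 would do so for sin x. *)
Lemma pi_bounds : 305 / 100 <= (pi : R) <= 317 / 100.
Proof.
have p2 := pi_ge2 R.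
have p4 : (pi : R) < 4 by have := pihalf_lt2 R; lra.
pose x : R := pi / 4.
have x0 : 0 <= x by rewrite /x; lra.
have e1 := cos2Dsin2 x.
have e2 : cos x ^+ 2 - sin x ^+ 2 = 0.
  have := cosD x x; rewrite (_ : x + x = pi / 2); last by rewrite /x; field.
  by rewrite cos_pihalf -!expr2 => <-.
have c2 : cos x ^+ 2 = 1 / 2 by lra.
have s2 : sin x ^+ 2 = 1 / 2 by lra.
have hc := cos_ge_quad x0; have hs := sin_ge_cubic x0.
have px : pi = 4 * x by rewrite /x; field.
rewrite px in p2 p4 *.
apply/andP; split; rewrite leNgt; apply/negP => h.
  have h1 : x < 763 / 1000 by lra.
  have h2 : 708 / 1000 <= cos x by nra.
  by move: c2; nra.
have h1 : 792 / 1000 < x by lra.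
have h2 : x <= 1 by lra.
have h3 : 708 / 1000 <= sin x.
  apply: le_trans hs.
  (* The factored difference of the values of y - y^3 / 6 at x and at 0.792. *)
  have : 0 <= (x - 792 / 1000) * (1 - (x ^+ 2 + x * (792 / 1000) + (792 / 1000) ^+ 2) / 6).
    by apply: mulr_ge0; [lra|nra].
  by nra.
by move: s2; nra.
Qed.

(** The series of -ln x in powers of 1 - x, cut after three terms; the difference has derivative (1
    - y)^3 / y, of constant sign on (0, 1], and vanishes at 1. *)
Lemma lnN_ge_cubic x : 0 < x -> x <= 1 ->
  (1 - x) + (1 - x) ^+ 2 / 2 + (1 - x) ^+ 3 / 3 <= - ln x.
Proof.
move=> x0 x1.
pose g y : R := ln y + ((1 - y) + (1 - y) ^+ 2 / 2 + (1 - y) ^+ 3 / 3).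
pose dg y : R := (1 - y) ^+ 3 / y.
have D y : 0 < y -> is_derive y (1 : R) g (dg y).
  move=> y0.
  have D1 : is_derive y (1 : R) (fun y : R => 1 - y : R) (- 1).
    by have := is_deriveB (is_derive_cst (1 : R) y (1 : R)) (is_derive_id y (1 : R)); rewrite sub0r.
  have h := is_deriveD (is_derive1_ln y0) (is_deriveD (is_deriveD D1 (is_deriveZ 2^-1 (is_deriveX 2 D1)))
     (is_deriveZ 3^-1 (is_deriveX 3 D1))).
  rewrite (_ : g = (@ln R + ((fun y : R => 1 - y : R) + 2^-1 \*: ((fun y : R => 1 - y : R) ^+ 2)
     + 3^-1 \*: ((fun y : R => 1 - y : R) ^+ 3)))); last first.
    by apply/funext => z; rewrite /g !fctE /GRing.scale/= [_ / 2]mulrC [_ / 3]mulrC.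
  by apply: is_derive_eq h _; rewrite /dg /GRing.scale/=; field; rewrite gt_eqF.
have [||c cx gc] := @MVT_segment _ g dg x 1 x1.
- by move=> y; rewrite in_itv/= => /andP[xy _]; apply: D; exact: lt_trans xy.
- apply: continuous_in_subspaceT => y; rewrite inE/= in_itv/= => /andP[xy _].
  by apply/differentiable_continuous/derivable1_diffP; case: (D y (lt_le_trans x0 xy)).
have g1 : g 1 = 0 by rewrite /g ln1 subrr !expr0n/= !mul0r !addr0.
have : 0 <= dg c * (1 - x).
  move: cx; rewrite in_itv/= => /andP[xc c1].
  by rewrite mulr_ge0 ?subr_ge0// divr_ge0 ?exprn_ge0 ?subr_ge0// (le_trans _ xc)// ltW.
by rewrite -gc g1 /g; lra.
Qed.

(* The integral of [avg_abs r] against the density [max 0 (ln (l / `|z|)) / (2 * l)],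
   whose first absolute moment is [l / 4]. The Gaussian law of variance
   [pi * l ^+ 2 / 32] has the same first absolute moment. *)
Definition log_profile r l : R :=
  if r <= l then r * l / 4 + r ^+ 3 / l * (11 / 36 + ln (l / r) / 6)
  else r ^+ 2 / 2 + l ^+ 2 / 18.

(** Everything is homogeneous, so x = r / l is the only variable. For x > 1 the claim is pi / 64 <=
    1 / 18. For x <= 1 neither Gaussian bound suffices alone: the quadratic one fails near 0 and the
    peak one near 1. Both are good enough around x = 0.43, where the cases are split. *)
Lemma integral_avg_abs_gauss_le r l : 0 <= r -> 0 < l ->
  (\int[@lebesgue_measure R]_x (avg_abs r x * gauss_pdf (pi * l ^+ 2 / 32) x)%:E <=
   (log_profile r l)%:E)%E.
Proof.
move=> r0 l0; have /andP[pi1 pi2] := pi_bounds.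
have pi0 := pi_gt0 R.
set v := pi * l ^+ 2 / 32.
have v0 : 0 < v by rewrite /v !mulr_gt0 ?exprn_gt0// pi_gt0.
have sv : Num.sqrt (2 * pi * v) = pi * l / 4.
  rewrite (_ : 2 * pi * v = (pi * l / 4) ^+ 2); last by rewrite /v; field.
  by rewrite sqrtr_sqr ger0_norm// !mulr_ge0 ?pi_ge0 ?ltW.
have ub1 := integral_avg_abs_gauss_ub1 v0 r0.
have ub2 := integral_avg_abs_gauss_ub2 v0 r0.
rewrite sv (_ : 2 * v / (pi * l / 4) = l / 4) in ub2; last first.
  rewrite /v; move: pi0; generalize (pi : R) => p p0; field.
  by rewrite !gt_eqF.
have [x rx] : exists x, r = x * l by exists (r / l); rewrite divfK// gt_eqF.
have x0 : 0 <= x by move: r0; rewrite rx pmulr_lge0.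
have l2 : 0 < l ^+ 2 by rewrite exprn_gt0.
rewrite /log_profile; case: ifPn => [rl|]; last first.
  rewrite -ltNge => lr; apply: le_trans ub1 _; rewrite lee_fin /v.
  by rewrite lerD2l; nra.
have x1 : x <= 1 by move: rl; rewrite rx -{2}[l]mul1r ler_pM2r.
have -> : r * l / 4 + r ^+ 3 / l * (11 / 36 + ln (l / r) / 6) =
    l ^+ 2 * (x / 4 + x ^+ 3 * (11 / 36 - ln x / 6)).
  have [x00|xn0] := eqVneq x 0.
    by rewrite rx x00 !mul0r expr0n/= !mul0r !addr0 mulr0.
  rewrite (_ : l / r = x^-1); last by rewrite rx; field; rewrite xn0 gt_eqF.
  rewrite lnV; last by rewrite posrE lt_def xn0.
  by rewrite rx; field; rewrite gt_eqF.
(* For small x the terms x / 4 cancel and the cubic coefficients are compared: 4 / (3 pi) against 11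
   / 36 - ln x / 6. *)
have [xs|xs] := leP x (43 / 100).
  apply: le_trans ub2 _; rewrite lee_fin.
  have -> : r * (l / 4) + r ^+ 3 / 3 / (pi * l / 4) = l ^+ 2 * (x / 4 + x ^+ 3 * (4 / (3 * pi))).
    rewrite rx; move: pi0; generalize (pi : R) => p p0; field.
    by rewrite !gt_eqF.
  rewrite ler_pM2l// lerD2l.
  have [->|xn0] := eqVneq x 0; first by rewrite expr0n/= !mul0r.
  rewrite ler_wpM2l ?exprn_ge0//.
  have xp : 0 < x by rewrite lt_def xn0.
  have h : 794 / 1000 <= - ln x.
    apply: le_trans (lnN_ge_cubic xp x1).
    have t1 : 57 / 100 <= 1 - x by lra.
    by nra.
  apply: (@le_trans _ _ (4 / (3 * (305 / 100)))); last by lra.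
  rewrite ler_pM2l// lef_pV2 ?posrE; [lra|lra|lra].
apply: le_trans ub1 _; rewrite lee_fin.
have -> : r ^+ 2 / 2 + v / 2 = l ^+ 2 * (x ^+ 2 / 2 + pi / 64) by rewrite rx /v; field.
rewrite ler_pM2l//.
have xp : 0 < x by lra.
have h := lnN_ge_cubic xp x1.
have x3 : 0 <= x ^+ 3 by rewrite exprn_ge0.
apply: (@le_trans _ _ (x / 4 + x ^+ 3 * (11 / 36 +
    ((1 - x) + (1 - x) ^+ 2 / 2 + (1 - x) ^+ 3 / 3) / 6))); last first.
  by rewrite lerD2l ler_wpM2l//; lra.
(* Expansion at x = 1, where the profile joins x^2 / 2 + 1 / 18. The defect is of fourth order in t,
   hence smaller than the gap between 1 / 18 and pi / 64. *)
pose t := 1 - x; have tx : x = 1 - t by rewrite /t; ring.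
have t0 : 0 <= t by rewrite /t; lra.
have t1 : t <= 57 / 100 by rewrite /t; lra.
have -> : x / 4 + x ^+ 3 * (11 / 36 + ((1 - x) + (1 - x) ^+ 2 / 2 + (1 - x) ^+ 3 / 3) / 6) =
   x ^+ 2 / 2 + (1 / 18 - t ^+ 3 * (t * (1 / 12 - t / 12 + t ^+ 2 / 18))).
  by rewrite tx; field.
rewrite lerD2l.
have q1 : t * (1 / 12 - t / 12 + t ^+ 2 / 18) <= 31 / 1000 by nra.
have q2 : t ^+ 3 <= 186 / 1000.
  apply: (@le_trans _ _ ((57 / 100) ^+ 3)); last by lra.
  by rewrite lerXn2r// nnegrE; lra.
have q3 : 0 <= t ^+ 3 by rewrite exprn_ge0.
have q0 : 0 <= t * (1 / 12 - t / 12 + t ^+ 2 / 18) by apply: mulr_ge0; [exact: t0|nra].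
by have := ler_pM q3 q0 q2 q1; lra.
Qed.

(** With y = s^2 this is ln y <= 2 (sqrt y - 1), sharper than ln y <= y - 1 and still polynomial in
    s. *)
Lemma ln_le_sqrt s : 0 < s -> @ln R (s ^+ 2) <= 2 * (s - 1).
Proof.
move=> s0; rewrite lnXn// -(mulr_natl (ln s)) ler_wpM2l//.
by have := @le_ln1Dx R (s - 1); rewrite [1 + _]addrC subrK; apply; lra.
Qed.

Lemma ln_ge_sqrt s : 0 < s -> 2 * (1 - s^-1) <= @ln R (s ^+ 2).
Proof.
move=> s0; have := @ln_le_sqrt s^-1; rewrite invr_gt0 => /(_ s0).
by rewrite exprVn lnV ?posrE ?exprn_gt0//; lra.
Qed.

(* The integral of [max 0 (ln (v / z)) * avg_abs r z] over [0 < z]. *)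
Definition log_moment r v : R :=
  if r <= v then r * v ^+ 2 / 4 + r ^+ 3 * (11 / 36 + ln (v / r) / 6)
  else r ^+ 2 * v / 2 + v ^+ 3 / 18.

(** In units of r, [log_moment r v / v] becomes x / 4 + (11 / 36 + ln x / 6) / x for x = v / r >= 1.
    The left side is x times its tangent at x0. *)
Lemma log_tangent_ge1 (x0 x : R) : 1 <= x0 -> 1 <= x ->
  (4 / 9 + ln x0 / 3) / x0 * x + (1 / 4 - (5 / 36 + ln x0 / 6) / x0 ^+ 2) * x ^+ 2
  <= x ^+ 2 / 4 + 11 / 36 + ln x / 6.
Proof.
move=> x01 x1.
have x0p : 0 < x0 by lra.
have xp : 0 < x by lra.
have l0 := ln_ge0 x01; have l1 := ln_ge0 x1.
pose y := x / x0; have yp : 0 < y by rewrite divr_gt0.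
have xy : x = x0 * y by rewrite /y mulrCA divff ?mulr1// gt_eqF.
pose s := Num.sqrt y; have sp : 0 < s by rewrite sqrtr_gt0.
have ys : y = s ^+ 2 by rewrite sqr_sqrtr// ltW.
have lx : ln x = ln x0 + ln y by rewrite xy lnM.
have lb := ln_ge_sqrt sp; rewrite -ys in lb.
(* With x = x0 y the terms x^2 / 4 cancel and a lower bound for ln y is left, with equality at y =
   1. *)
suff : - ((1 - y) * (11 - 5 * y) / 6) - ln x0 * (1 - y) ^+ 2 <= ln y.
  move=> h; rewrite lx.
  rewrite (_ : _ + _ * x ^+ 2 = x ^+ 2 / 4 + (4 / 9 + ln x0 / 3) * y - (5 / 36 + ln x0 / 6) * y ^+ 2).
    by move: h; nra.
  by rewrite xy; field; rewrite gt_eqF.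
have si : 2 * (1 - s^-1) * s = 2 * (s - 1) by field; rewrite gt_eqF.
have [y1|y1] := leP 1 y.
  have s1 : 1 <= s by rewrite -(expr_ge1 (n := 2))// -?ys// ltW.
  have h0 : 0 <= ln x0 * (1 - y) ^+ 2 by rewrite mulr_ge0// sqr_ge0.
  suff : - ((1 - y) * (11 - 5 * y) / 6) <= ln y by lra.
  apply: le_trans lb; rewrite -(ler_pM2r sp) si ys.
  have : 0 <= (s - 1) * ((s - 1) * (5 * s ^+ 3 + 10 * s ^+ 2 - s - 12)).
    apply: mulr_ge0; first lra.
    apply: mulr_ge0; first lra.
    by nra.
  by nra.
have s1 : s < 1 by rewrite -(expr_lt1 (n := 2))// -?ys// ltW.
(* Here x0 y >= 1 is what counts: it bounds -ln y by ln x0, so the term in ln x0 can be traded for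
   one in ln y. *)
have ll : - ln y <= ln x0 by lra.
have y20 : 0 <= (1 - y) ^+ 2 by exact: sqr_ge0.
have h0 := ler_wpM2r y20 ll.
suff : (- ln y) * (1 - (1 - y) ^+ 2) <= (1 - y) * (11 - 5 * y) / 6 by nra.
have c0 : 0 <= 1 - (1 - y) ^+ 2 by nra.
have lb' : - ln y <= - (2 * (1 - s^-1)) by lra.
apply: le_trans (ler_wpM2r c0 lb') _; rewrite -(ler_pM2r sp).
rewrite (_ : - (2 * (1 - s^-1)) * (1 - (1 - y) ^+ 2) * s = - (2 * (1 - s^-1) * s) * (1 - (1 - y) ^+ 2)); last ring.
rewrite si ys.
have : 0 <= s * (1 - s) * ((1 - s) * (11 - 2 * s - 7 * s ^+ 2)).
  apply: mulr_ge0; first by apply: mulr_ge0; lra.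
  by apply: mulr_ge0; [lra|nra].
by nra.
Qed.

(* The tangent at [l] to the convex function [v |-> log_moment r v / v]: integrated against a
   mixing measure of first moment [1] and second moment [l], it is Jensen's inequality. *)
Lemma log_moment_tangent r l : 0 <= r -> 0 < l ->
  exists b0 b1, [/\ 0 <= b0, 0 <= b1, b0 + b1 * l = log_profile r l &
    forall v, 0 < v -> b0 * v + b1 * v ^+ 2 <= log_moment r v].
Proof.
rewrite le_eqVlt => /predU1P[<- l0|r0 l0].
  exists 0, 0; split => //.
    by rewrite /log_profile (ltW l0) expr0n/= !mul0r !add0r.
  by move=> v v0; rewrite /log_moment (ltW v0) expr0n/= !mul0r !add0r.
pose x0 := l / r; have x0p : 0 < x0 by rewrite divr_gt0.
have lE : l = x0 * r by rewrite /x0 divfK// gt_eqF.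
have r2 : 0 < r ^+ 2 by rewrite exprn_gt0.
have r3 : 0 < r ^+ 3 by rewrite exprn_gt0.
pose c x : R := if 1 <= x then x ^+ 2 / 4 + 11 / 36 + ln x / 6 else x / 2 + x ^+ 3 / 18.
have cE v : 0 < v -> log_moment r v = r ^+ 3 * c (v / r).
  move=> v0; rewrite /log_moment /c ler_pdivlMr// mul1r; by case: ifP => _; field; rewrite gt_eqF.
have pE : log_profile r l = r ^+ 2 * (c x0 / x0).
  rewrite /log_profile /c /x0 ler_pdivlMr// mul1r; by case: ifP => _; field; rewrite !gt_eqF.
(* By homogeneity only the tangent to c(x) / x at x0 is left. Nonnegative coefficients will allow it
   to be integrated term by term in the extended reals. *)
suff [b0 [b1 [b00 b10 be bl]]] : exists b0 b1 : R, [/\ 0 <= b0, 0 <= b1,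
    b0 + b1 * x0 = c x0 / x0 & forall x, 0 < x -> b0 * x + b1 * x ^+ 2 <= c x].
  exists (r ^+ 2 * b0), (r * b1); split.
  - by rewrite mulr_ge0// ltW.
  - by rewrite mulr_ge0// ltW.
  - by rewrite pE -be lE; ring.
  - move=> v v0; rewrite cE//.
    have := bl (v / r) (divr_gt0 v0 r0); rewrite -(ler_pM2l r3); apply: le_trans.
    by rewrite le_eqVlt; apply/orP; left; apply/eqP; field; rewrite gt_eqF.
(* The tangent at 1, where the two branches of c(x) / x meet with value 5/9 and slope 1/9. For x0 <
   1 <= x it lies between the tangent at x0 and the function. *)
have t1 := log_tangent_ge1 (lexx (1 : R)).
have {}t1 x : 1 <= x -> 4 / 9 * x + x ^+ 2 / 9 <= x ^+ 2 / 4 + 11 / 36 + ln x / 6.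
  by move=> /t1; rewrite ln1; lra.
have [x01|x01] := leP 1 x0; last first.
  exists (1 / 2 - x0 ^+ 2 / 18), (x0 / 9); split.
  - by nra.
  - by lra.
  - by rewrite /c leNgt x01/=; field; rewrite gt_eqF.
  - move=> x xp; rewrite /c; case: ifPn => [x1|].
      apply: le_trans (t1 _ x1); have : 0 <= (1 - x0) * (2 * x - 1 - x0) by apply: mulr_ge0; lra.
      by nra.
    rewrite -ltNge => x1; have := mulr_ge0 (ltW xp) (sqr_ge0 (x - x0)); nra.
have l0' := ln_ge0 x01.
have t2 := log_tangent_ge1 x01.
set b0 := (4 / 9 + ln x0 / 3) / x0 in t2 *.
set b1 := 1 / 4 - _ in t2 *.
(* A slope no smaller than the one at 1 keeps the tangent below the other branch when x < 1. *)
have b19 : 1 / 9 <= b1.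
  have lx : ln x0 <= x0 - 1.
    by have := @le_ln1Dx R (x0 - 1); rewrite [1 + _]addrC subrK; apply; lra.
  have : (5 / 36 + ln x0 / 6) / x0 ^+ 2 <= 5 / 36.
    by rewrite ler_pdivrMr ?exprn_gt0//; nra.
  by rewrite /b1; lra.
exists b0, b1; split.
- by rewrite divr_ge0//; lra.
- by lra.
- by rewrite /c x01 /b0 /b1; field; rewrite gt_eqF.
- move=> x xp; rewrite /c; case: ifPn => [x1|]; first exact: t2.
  rewrite -ltNge => x1.
  have := t2 1 (lexx _); rewrite ln1 !expr1n => h.
  have : b0 + b1 * x <= 1 / 2 + x ^+ 2 / 18.
    have := sqr_ge0 (1 - x); nra.
  by move=> /(ler_wpM2l (ltW xp)); nra.
Qed.

End numeric.

(** * The Bessel function as a mixture of logarithms *)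

Section bessel.
Context (R : realType).
Implicit Types (r s t u v x y z a c : R).
Local Notation mu := (@lebesgue_measure R).

Lemma ge0_integral_even (f : R -> R) : measurable_fun setT f -> (forall x, 0 <= f x) ->
  (forall x, f (- x) = f x) ->
  (\int[mu]_x (f x)%:E = 2%:E * \int[mu]_(x in `]0%R, +oo[) (f x)%:E)%E.
Proof.
move=> mf f0 fN; have mfE : measurable_fun setT (EFin \o f) by exact/measurable_EFinP.
have I0 : (\int[mu]_(x in [set x | 0 <= x]%R) (f x)%:E =
    \int[mu]_(x in `]0%R, +oo[) (f x)%:E)%E.
  by rewrite -set_itvcy integral_itv_obnd_cbnd//; exact: measurable_funTS.
have mpos : measurable [set x : R | 0 <= x]%R by rewrite -set_itvcy.
rewrite -(setUv [set x : R | 0 <= x]%R) ge0_integral_setU//=; last 4 first.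
- exact: measurableC.
- by rewrite setUv.
- by move=> x _; rewrite lee_fin.
- exact/disj_setPCl.
rewrite I0 mule_natl mule2n; congr +%E.
rewrite -set_itvcy setCitvr -I0 -set_itvcy.
rewrite integral_itv_bndo_bndc; last exact: measurable_funTS.
rewrite [RHS](ge0_integration_by_substitution0 mfE)//.
by apply: eq_integral => x _; rewrite /= fN.
Qed.

Lemma integral_expN c a : 0 < c ->
  (\int[mu]_(t in `[a, +oo[) (expR (- (c * t)))%:E = (expR (- (c * a)) / c)%:E)%E.
Proof.
move=> c0.
pose F t : R := - (expR (- (c * t)) / c).
have D t : is_derive t (1 : R) F (expR (- (c * t))).
  have D1 : is_derive t (1 : R) (fun t : R => - (c * t) : R) (- c).
    have := is_deriveN (is_deriveZ c (is_derive_id t (1 : R))).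
    by rewrite /GRing.scale/= mulr1.
  have h := is_deriveN (is_deriveZ c^-1 (@is_derive1_comp _ expR _ t _ _ (is_derive_expR _) D1)).
  rewrite (_ : F = - (c^-1 \*: (expR \o (fun t : R => - (c * t) : R)))); last first.
    by apply/funext => y; rewrite /F !fctE /GRing.scale/= mulrC.
  by apply: is_derive_eq h _; rewrite /GRing.scale/=; field; rewrite gt_eqF.
have cF : continuous F.
  by move=> x; apply/differentiable_continuous/derivable1_diffP; case: (D x).
have cf : continuous (fun t : R => expR (- (c * t))).
  move=> x; apply: (@continuous_comp _ _ _ (fun t : R => - (c * t)) expR); last exact: continuous_expR.
  by apply: cvgN; apply: cvgM; [exact: cvg_cst|exact: cvg_id].
rewrite (@ge0_continuous_FTC2y _ _ F a 0)//.
- by rewrite -EFinB sub0r /F opprK.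
- exact: continuous_subspaceT.
- rewrite -oppr0 -(mul0r c^-1); apply: cvgN; apply: cvgM; last exact: cvg_cst.
  apply: (@cvg_comp _ _ _ (fun t : R => c * t) (fun x => expR (- x)) _ +oo%R); last exact: cvgr_expR.
  apply/cvgryPge => A; near=> t.
  by rewrite mulrC -ler_pdivrMr//; near: t; exact: nbhs_pinfty_ge.
- exact/cvg_at_right_filter/cF.
- by move=> x _; rewrite derive1E; case: (D x).
Unshelve. all: end_near. Qed.

Lemma integral_expN_gt a : 0 <= a ->
  (\int[mu]_(t in `]0%R, +oo[) (expR (- t) * (a < t)%R%:R)%:E = (expR (- a))%:E)%E.
Proof.
move=> a0; transitivity (\int[mu]_(t in `]a, +oo[) (expR (- (1 * t)))%:E)%E.
  rewrite [LHS]integral_mkcond [RHS]integral_mkcond; apply: eq_integral => t _.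
  rewrite !patchE !mem_setE !in_itv/= !andbT mul1r.
  case: (ltP a t) => [at_|ta]; first by rewrite (le_lt_trans a0 at_) mulr1.
  by rewrite mulr0; case: ifP.
rewrite integral_itv_obnd_cbnd; first by rewrite integral_expN// mul1r divr1.
apply/measurable_EFinP/measurable_funTS; apply: measurableT_comp => //.
by apply: measurable_funN; exact: measurable_funM.
Qed.

Definition posln x : R := Num.max 0 (ln x).

Lemma posln_ge0 x : 0 <= posln x.
Proof. by rewrite le_max lexx. Qed.

Lemma measurable_posln d (T : measurableType d) (f : T -> R) :
  measurable_fun setT f -> measurable_fun setT (fun p => posln (f p)).
Proof.
move=> mf; apply: measurable_maxr => //; exact: measurableT_comp.
Qed.

(** The two conditions on s cut out the interval from -ln (u / a) to ln (t / a), of length ln (t u /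
    a^2); it is empty when this is negative, whence the positive part. *)
Lemma integral_exp_window a t u : 0 < a -> 0 < t -> 0 < u ->
  (\int[mu]_s ((a * expR s < t)%R%:R * (a * expR (- s) < u)%R%:R)%:E =
   (posln (t * u / a ^+ 2))%:E)%E.
Proof.
move=> a0 t0 u0.
have E s : ((a * expR s < t)%R%:R * (a * expR (- s) < u)%R%:R : R) =
    \1_(`]- ln (u / a), ln (t / a)[%classic : set R) s.
  rewrite indicE mem_setE in_itv/= -natrM mulnb andbC; congr (_ && _)%:R.
    by rewrite ltrNl -[in RHS]ltr_expR lnK ?posrE ?divr_gt0// ltr_pdivlMr// mulrC.
  by rewrite -[in RHS]ltr_expR lnK ?posrE ?divr_gt0// ltr_pdivlMr// mulrC.
under eq_integral do rewrite E.
rewrite integral_indic// setIT.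
apply: etrans (lebesgue_measure_itv _) _; rewrite /= lte_fin.
rewrite /posln; have -> : ln (t * u / a ^+ 2) = ln (t / a) + ln (u / a).
  by rewrite -lnM ?posrE ?divr_gt0// mulf_div -expr2.
case: ltP => h; first by rewrite -EFinB opprK max_r//; lra.
by congr EFin; apply/esym/max_l; lra.
Qed.

Let g x t : R := expR (- (x * ((expR t + expR (- t)) / 2))).

Let mg d (T : measurableType d) (h k : T -> R) : measurable_fun setT h -> measurable_fun setT k ->
  measurable_fun setT (fun p => g (h p) (k p)).
Proof.
move=> mh mk; apply: measurableT_comp => //; apply: measurable_funN.
apply: measurable_funM => //; apply: measurable_funM => //.
by apply: measurable_funD; apply: measurableT_comp => //; exact: measurable_funN.
Qed.

Lemma besselK0_ge0 x : 0 <= besselK0 x.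
Proof. by apply: Rintegral_ge0 => t _; exact: expR_ge0. Qed.

(** [besselK0] is the real part of an extended integral, so the identity rests on convergence, which
    follows from cosh t >= t / 2. *)
Lemma besselK0_fin x : 0 < x ->
  ((besselK0 x)%:E = \int[mu]_(t in `[0%R, +oo[) (g x t)%:E)%E.
Proof.
move=> x0; rewrite /besselK0 /Rintegral fineK// ge0_fin_numE; last first.
  by apply: integral_ge0 => t _; rewrite lee_fin expR_ge0.
apply: (@le_lt_trans _ _ (\int[mu]_(t in `[0%R, +oo[) (expR (- (x / 2 * t)))%:E)%E); last first.
  by rewrite integral_expN ?divr_gt0// ltry.
apply: ge0_le_integral => //.
- by apply/measurable_EFinP/measurable_funTS; exact: mg.
- apply/measurable_EFinP/measurable_funTS; apply: measurableT_comp => //.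
  by apply: measurable_funN; exact: measurable_funM.
- move=> t _; rewrite lee_fin ler_expR lerN2 -mulrA ler_pM2l// mulrC ler_pM2r ?invr_gt0//.
  have := expR_ge1Dx t; have := expR_gt0 (- t); lra.
Qed.

Lemma besselK0_le x y : 0 < x -> x <= y -> besselK0 y <= besselK0 x.
Proof.
move=> x0 xy; have y0 := lt_le_trans x0 xy.
rewrite -lee_fin !besselK0_fin//; apply: ge0_le_integral => //.
- by move=> t _; rewrite lee_fin expR_ge0.
- by apply/measurable_EFinP/measurable_funTS; exact: mg.
- by apply/measurable_EFinP/measurable_funTS; exact: mg.
- move=> t _; rewrite lee_fin ler_expR lerN2 ler_wpM2r// divr_ge0// addr_ge0//; exact: expR_ge0.
Qed.

Lemma measurable_besselK0 : measurable_fun setT (@besselK0 R).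
Proof.
apply: measurableT_comp => //=.
apply: (measurable_integralD_r mu (f := g)) => //; first exact: mg.
by move=> x t; exact: expR_ge0.
Qed.

(* [exp (- a e^s) exp (- a e^-s)] is the probability that two independent standard exponential
   variables exceed [a e^s] and [a e^-s]; one integrates over [s] first. *)
Lemma besselK0_mixture x : 0 < x ->
  ((2 * besselK0 x)%:E = \int[mu]_(t in `]0%R, +oo[) \int[mu]_(u in `]0%R, +oo[)
     (expR (- t) * (expR (- u) * posln (t * u / (x / 2) ^+ 2)))%:E)%E.
Proof.
move=> x0; pose a := x / 2; have a0 : 0 < a by rewrite divr_gt0.
(* The factor 2 unfolds the even integrand to the whole line, so the window in s meets no constraint
   at 0. *)
rewrite EFinM besselK0_fin// set_itvcy -ge0_symfun_integralT; last 3 first.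
- by move=> t; exact: expR_ge0.
- move=> t; apply: (@continuous_comp _ _ _ (fun t : R => - (x * ((expR t + expR (- t)) / 2))) expR); last exact: continuous_expR.
  apply: cvgN; apply: cvgM; first exact: cvg_cst.
  apply: cvgM; last exact: cvg_cst.
  apply: cvgD; first exact: continuous_expR.
  by apply: (@continuous_comp _ _ _ (fun t : R => - t) expR); [apply: cvgN; exact: cvg_id|exact: continuous_expR].
- by move=> t; rewrite /g/= opprK [expR (- t) + _]addrC.
pose k (q : R * R * R) : R := (expR (- q.1.2) * (a * expR q.1.1 < q.1.2)%R%:R) *
   (expR (- q.2) * (a * expR (- q.1.1) < q.2)%R%:R).
have mk d (T : measurableType d) (b1 b2 b3 : T -> R) : measurable_fun setT b1 ->
    measurable_fun setT b2 -> measurable_fun setT b3 ->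
    measurable_fun setT (fun p => k (b1 p, b2 p, b3 p)).
  move=> m1 m2 m3; apply: measurable_funM; apply: measurable_funM.
  - by apply: measurableT_comp => //; exact: measurable_funN.
  - apply: measurable_ltr_natr => //; apply: measurable_funM => //.
    exact: measurableT_comp.
  - by apply: measurableT_comp => //; exact: measurable_funN.
  - apply: measurable_ltr_natr => //; apply: measurable_funM => //.
    by apply: measurableT_comp => //; exact: measurable_funN.
have k0 q : 0 <= k q by rewrite !mulr_ge0 ?expR_ge0.
transitivity (\int[mu]_s \int[mu]_(t in `]0%R, +oo[) \int[mu]_(u in `]0%R, +oo[) (k (s, t, u))%:E)%E.
  apply: eq_integral => s _.
  transitivity (\int[mu]_(t in `]0%R, +oo[) (expR (- (a * expR (- s))) * (expR (- t) * (a * expR s < t)%R%:R))%:E)%E; last first.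
    apply: eq_integral => t _; rewrite /k/= ge0_integralZ_EFin//=.
    - by rewrite integral_expN_gt ?mulr_ge0 ?ltW ?expR_gt0// -EFinM mulrC.
    - apply: measurable_funTS; apply: measurable_funM; last exact: measurable_ltr_natr.
      by apply: measurableT_comp => //; exact: measurable_funN.
  rewrite ge0_integralZ_EFin//=.
  - rewrite integral_expN_gt ?mulr_ge0 ?ltW ?expR_gt0// -EFinM -expRD; congr (expR _)%:E.
    by rewrite /a; field.
  - apply: measurable_funTS; apply: measurable_funM; last exact: measurable_ltr_natr.
    by apply: measurableT_comp => //; exact: measurable_funN.
rewrite (@tonelliD _ _ _ _ _ mu mu setT `]0%R, +oo[%classic
  (fun s t => \int[mu]_(u in `]0%R, +oo[) (k (s, t, u))%:E)%E)//; last 2 first.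
- apply: (measurable_integralD_r mu (f := fun (p : R * R) u => k (p.1, p.2, u))) => //.
  by apply: mk => //; exact: measurableT_comp.
- by move=> s t; apply: integral_ge0 => u _; rewrite lee_fin.
apply: eq_integral => t; rewrite inE/= in_itv/= andbT => t0.
rewrite (@tonelliD _ _ _ _ _ mu mu setT `]0%R, +oo[%classic
  (fun s u => (k (s, t, u))%:E)%E)//; last 2 first.
- exact/measurable_EFinP/mk.
- by move=> *; rewrite lee_fin.
apply: eq_integral => u; rewrite inE/= in_itv/= andbT => u0.
rewrite /k/= -/a mulrA EFinM -integral_exp_window// -ge0_integralZ_EFin//.
- by apply: eq_integral => s _; congr EFin; rewrite mulrACA.
- apply: measurable_funM; apply: measurable_ltr_natr => //; apply: measurable_funM => //.
  by apply: measurableT_comp => //; exact: measurable_funN.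
Qed.

End bessel.

(** * Moments of the logarithmic profile *)

Section mixture.
Context (R : realType).
Implicit Types (r s t u v x y z a c : R).
Local Notation mu := (@lebesgue_measure R).
Local Notation D := (`]0%R, +oo[%classic : set R).

Lemma integral2_comb (b0 b1 : R) (h0 h1 : R -> R -> R) : 0 <= b0 -> 0 <= b1 ->
  measurable_fun setT (fun p : R * R => h0 p.1 p.2) ->
  measurable_fun setT (fun p : R * R => h1 p.1 p.2) ->
  (forall x y, 0 <= h0 x y) -> (forall x y, 0 <= h1 x y) ->
  (\int[mu]_(x in D) \int[mu]_(y in D) (b0 * h0 x y + b1 * h1 x y)%:E =
   b0%:E * (\int[mu]_(x in D) \int[mu]_(y in D) (h0 x y)%:E) +
   b1%:E * (\int[mu]_(x in D) \int[mu]_(y in D) (h1 x y)%:E))%E.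
Proof.
move=> b00 b10 m0 m1 h00 h10.
have mx (h : R -> R -> R) x : measurable_fun setT (fun p : R * R => h p.1 p.2) ->
    measurable_fun D (h x).
  move=> mh; apply: measurable_funTS.
  exact: (measurableT_comp mh (pair1_measurable x)).
have mI (h : R -> R -> R) : measurable_fun setT (fun p : R * R => h p.1 p.2) ->
    (forall x y, 0 <= h x y) -> measurable_fun D (fun x => \int[mu]_(y in D) (h x y)%:E)%E.
  by move=> mh h_ge0; apply: measurable_funTS; exact: measurable_integralD_r.
transitivity (\int[mu]_(x in D) (b0%:E * (\int[mu]_(y in D) (h0 x y)%:E) +
    b1%:E * (\int[mu]_(y in D) (h1 x y)%:E)))%E.
  apply: eq_integral => x _; under eq_integral do rewrite EFinD.
  rewrite ge0_integralD//.
  - by rewrite !ge0_integralZ_EFin//; exact: mx.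
  - by move=> y _; rewrite lee_fin mulr_ge0.
  - by apply/measurable_EFinP; apply: measurable_funM => //; exact: mx.
  - by move=> y _; rewrite lee_fin mulr_ge0.
  - by apply/measurable_EFinP; apply: measurable_funM => //; exact: mx.
have I0 (h : R -> R -> R) : (forall x y, 0 <= h x y) ->
    forall x, (0 <= \int[mu]_(y in D) (h x y)%:E)%E.
  by move=> hge0 x; apply: integral_ge0 => y _; rewrite lee_fin.
rewrite ge0_integralD//.
- by rewrite !ge0_integralZl//; try exact: mI; move=> x _; exact: I0.
- by move=> x _; rewrite mule_ge0 ?lee_fin ?I0.
- by apply: emeasurable_funM => //; exact: mI.
- by move=> x _; rewrite mule_ge0 ?lee_fin ?I0.
- by apply: emeasurable_funM => //; exact: mI.
Qed.

Lemma integral_FTC2_pos (F f : R -> R) a b : 0 < a -> a <= b ->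
  (forall x, 0 < x -> is_derive x (1 : R) F (f x)) ->
  (forall x, 0 < x -> {for x, continuous f}) ->
  (\int[mu]_(x in `[a, b]) (f x)%:E = (F b - F a)%:E)%E.
Proof.
move=> a0; rewrite le_eqVlt => /predU1P[<- _ _|ab dF cf].
  by rewrite set_itv1 integral_set1 subrr.
have cF x : 0 < x -> {for x, continuous F}.
  by move=> x0; apply/differentiable_continuous/derivable1_diffP; case: (dF x x0).
have b0 := lt_trans a0 ab.
rewrite (continuous_FTC2 (F := F) ab)//.
- apply: continuous_in_subspaceT => x; rewrite inE/= in_itv/= => /andP[ax _].
  exact/cf/(lt_le_trans a0).
- split.
  + by move=> x; rewrite in_itv/= => /andP[ax _]; case: (dF x (lt_trans a0 ax)).
  + exact/cvg_at_right_filter/cF.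
  + exact/cvg_at_left_filter/cF.
- move=> x; rewrite in_itv/= => /andP[ax _].
  by rewrite derive1E; case: (dF x (lt_trans a0 ax)).
Qed.

Lemma is_derive_powR s x : 0 < x ->
  is_derive x (1 : R) (fun y : R => y `^ s : R) (s * x `^ (s - 1)).
Proof.
move=> x0; have xin : x \in `]0, +oo[ by rewrite in_itv/= x0.
apply: DeriveDef; first exact: derivable_powR.
by rewrite -derive1E powR_derive1.
Qed.

(** For s < 1 the integrand is unbounded at 0, so the fundamental theorem is applied on
    [t / (n + 1), t], followed by monotone convergence. *)
Lemma integral_powR s t : 0 < s -> 0 < t ->
  (\int[mu]_(u in D) ((u < t)%R%:R * (s * u `^ (s - 1)))%:E = (t `^ s)%:E)%E.
Proof.
move=> s0 t0; pose f u : R := s * u `^ (s - 1).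
have mf : measurable_fun setT f by apply: measurable_funM => //; exact: measurable_powR.
have f0 u : 0 <= f u by rewrite mulr_ge0 ?powR_ge0 ?ltW.
pose F n : set R := `[n.+1%:R^-1 * t, t]%classic.
have en n : 0 < n.+1%:R^-1 * t :> R by rewrite mulr_gt0.
have en1 n : n.+1%:R^-1 * t <= t by rewrite ger_pMl// invf_le1// ler1n.
have UF : \bigcup_n F n = `]0, t]%classic.
  apply/seteqP; split => x /=.
    by move=> [n _]; rewrite /F/= !in_itv/= => /andP[h ->]; rewrite (lt_le_trans (en n) h).
  rewrite in_itv/= => /andP[x0 xt]; exists (Num.truncn (t / x)) => //.
  rewrite /F/= in_itv/= xt andbT mulrC ler_pdivrMr// mulrC -ler_pdivrMr//.
  by rewrite ltW// truncnS_gt.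
have ndF : nondecreasing_seq F.
  move=> n m nm; apply/subsetPset => x; rewrite /F/= !in_itv/= => /andP[h ->].
  by rewrite andbT (le_trans _ h)// ler_pM2r// lef_pV2 ?posrE// ler_nat.
have c1 : (fun n => \int[mu]_(x in F n) (f x)%:E)%E @ \oo --> (\int[mu]_(x in `]0%R, t]) (f x)%:E)%E.
  rewrite -UF; apply: ge0_nondecreasing_set_cvg_integral => //.
  - by move=> n; exact: measurable_itv.
  - by move=> n; apply: measurable_funTS; exact: measurableT_comp.
  - by move=> n x _; rewrite lee_fin.
have c2 : (fun n => \int[mu]_(x in F n) (f x)%:E)%E @ \oo --> (t `^ s)%:E.
  have E n : (\int[mu]_(x in F n) (f x)%:E = (t `^ s - (n.+1%:R^-1 * t) `^ s)%:E)%E.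
    rewrite (@integral_FTC2_pos (fun y => y `^ s) f)//.
    - move=> x x0; apply: cvgM; first exact: cvg_cst.
      have : {for x, continuous (fun y : R => y `^ (s - 1))}.
        by apply/differentiable_continuous/derivable1_diffP; case: (is_derive_powR (s - 1) x0).
      exact.
  under eq_fun do rewrite E.
  apply: cvg_EFin; first by apply: nearW.
  rewrite -[X in _ --> X]subr0; apply: cvgB; first exact: cvg_cst.
  have := powR_cvg0 s0 => /cvg_at_rightP; apply; split => //.
  rewrite -(mul0r t); apply: cvgM; last exact: cvg_cst.
  exact: cvg_harmonic.
rewrite -(cvg_unique _ c1 c2)// -integral_itv_bndo_bndc; last first.
  by apply: measurable_funTS; exact: measurableT_comp.
rewrite [LHS]integral_mkcond [RHS]integral_mkcond; apply: eq_integral => u _.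
rewrite !patchE !mem_setE !in_itv/= !andbT.
by case: (ltP 0 u) => //= u0; case: ifP => _; rewrite ?mul1r ?mul0r.
Qed.

Lemma integral_posln1 v z : 0 < z -> 0 < v ->
  (\int[mu]_(u in D) ((z < u)%R%:R * ((u < v)%R%:R / u))%:E = (posln (v / z))%:E)%E.
Proof.
move=> z0 v0.
have mV : measurable_fun D (fun u : R => (u^-1)%:E).
  apply/measurable_EFinP; apply: open_continuous_measurable_fun => // u.
  by rewrite inE/= in_itv/= andbT => u0; apply: cvgV; [rewrite gt_eqF|exact: cvg_id].
transitivity (\int[mu]_(u in `]z, v[) (u^-1)%:E)%E.
  rewrite [LHS]integral_mkcond [RHS]integral_mkcond; apply: eq_integral => u _.
  rewrite !patchE !mem_setE !in_itv/= !andbT.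
  case: (ltP z u) => zu; last by rewrite mul0r; case: ifP.
  rewrite (lt_trans z0 zu)/= mul1r.
  by case: ifP; rewrite ?mul1r ?mul0r.
have lvz : ln (v / z) = ln v - ln z by rewrite ln_div.
have [zv|vz] := leP z v; last first.
  rewrite set_itv_ge ?integral_set0; last by rewrite bnd_simp -leNgt ltW.
  congr EFin; apply/esym/max_l; rewrite lvz subr_le0 ler_ln ?posrE//; exact: ltW.
rewrite -(integral_itv_bndoo true false); last first.
  apply: measurable_funS mV => // u /=; rewrite !in_itv/= andbT => /andP[zu _].
  exact: lt_trans zu.
rewrite (@integral_FTC2_pos (@ln R) (fun u => u^-1))//.
- congr EFin; rewrite /posln lvz max_r// subr_ge0 ler_ln ?posrE//.
- by move=> u u0; apply: cvgV; [rewrite gt_eqF|exact: cvg_id].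
Qed.

Lemma measurable_inv_ltr v : measurable_fun setT (fun u : R => (0 < u)%R%:R * ((u < v)%R%:R / u) : R).
Proof.
rewrite (_ : (fun _ => _) = (fun u : R => (if (0 < u) then (u < v)%R%:R * u `^ (-1) else 0 : R))); last first.
  by apply/funext => u; case: ltP => u0; rewrite ?mul0r// mul1r powR_inv1// ltW.
apply: measurable_fun_ifT => //; first exact: measurable_fun_ltr.
by apply: measurable_funM; [exact: measurable_ltr_natr|exact: measurable_powR].
Qed.

(** Since log_+(v / z) is the integral of 1 / u over z < u < v, Tonelli leaves the integral over u <
    v of the mean of psi on (0, u); [phi] is that mean. *)
Lemma integral_posln (psi phi : R -> R) v : 0 < v ->
  measurable_fun setT psi -> (forall z, 0 <= psi z) ->
  (forall u, (0 < u)%R -> \int[mu]_(z in D) ((z < u)%R%:R * psi z)%:E = (u * phi u)%:E)%E ->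
  (\int[mu]_(z in D) (posln (v / z) * psi z)%:E = \int[mu]_(u in `]0%R, v[) (phi u)%:E)%E.
Proof.
move=> v0 mpsi psi0 psiE.
pose h z u : R := (z < u)%R%:R * ((0 < u)%R%:R * ((u < v)%R%:R / u)).
have h0 z u : 0 <= h z u.
  rewrite /h; case: (ltP 0 u) => u0; rewrite ?mul0r ?mulr0// mul1r.
  by rewrite mulr_ge0// mulr_ge0// invr_ge0 ltW.
have mh : measurable_fun setT (fun p : R * R => h p.1 p.2).
  apply: measurable_funM; first exact: measurable_ltr_natr.
  exact: (measurableT_comp (measurable_inv_ltr v)).
transitivity (\int[mu]_(z in D) \int[mu]_(u in D) (psi z * h z u)%:E)%E.
  apply: eq_integral => z; rewrite inE/= in_itv/= andbT => z0.
  rewrite ge0_integralZ_EFin//.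
  - rewrite mulrC EFinM -integral_posln1//; congr (_ * _)%E; apply: eq_integral => u.
    by rewrite inE/= in_itv/= andbT /h => ->; rewrite mul1r.
  - apply: measurable_funTS; exact: (measurableT_comp mh (pair1_measurable z)).
rewrite (@tonelliD _ _ _ _ _ mu mu D D (fun z u => (psi z * h z u)%:E))//; last 2 first.
- by apply/measurable_EFinP; apply: measurable_funM => //; exact: measurableT_comp.
- by move=> z u; rewrite lee_fin mulr_ge0.
rewrite [LHS]integral_mkcond [RHS]integral_mkcond; apply: eq_integral => u _.
rewrite !patchE !mem_setE !in_itv/= !andbT.
case: (ltP 0 u) => //= u0.
have E z : psi z * h z u = ((u < v)%R%:R / u) * ((z < u)%R%:R * psi z).
  by rewrite /h u0 mul1r; ring.
under eq_integral do rewrite E.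
rewrite ge0_integralZ_EFin//.
- rewrite psiE// -EFinM; case: ifP => _; rewrite ?mul0r// mul1r mulrA mulVf ?mul1r//.
  by rewrite gt_eqF.
- by apply: measurable_funTS; apply: measurable_funM => //; exact: measurable_ltr_natr.
- by move=> z _; rewrite mulr_ge0.
- by rewrite mulr_ge0// invr_ge0 ltW.
Qed.

Lemma integral_posln_cst v : 0 < v ->
  (\int[mu]_(z in D) (posln (v / z))%:E = v%:E)%E.
Proof.
move=> v0.
have I (u : R) : 0 < u -> (\int[mu]_(x in `]0%R, u[) (1%R : R)%:E = u%:E)%E.
  move=> u0; rewrite integral_cst// mul1e; apply: etrans (lebesgue_measure_itv _) _.
  by rewrite /= lte_fin u0 oppr0 adde0.
under eq_integral do rewrite -[posln _]mulr1.
rewrite (@integral_posln (fun=> 1) (fun=> 1))//; first exact: I.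
move=> u u0; rewrite mulr1 -I//.
rewrite [LHS]integral_mkcond [RHS]integral_mkcond; apply: eq_integral => z _.
rewrite !patchE !mem_setE !in_itv/= !andbT.
by case: (ltP 0 z) => //= z0; rewrite mulr1; case: ifP.
Qed.

Let avg_prim r u : R := ((u + r) ^+ 3 - `|r - u| ^+ 3) / 12.

Lemma integral_avg_abs0 r u : 0 <= r -> 0 < u ->
  (\int[mu]_(z in D) ((z < u)%R%:R * avg_abs r z)%:E = (avg_prim r u)%:E)%E.
Proof.
move=> r0 u0.
have D1 x : is_derive x (1 : R)
    (fun y : R => (`|1 * y + r| ^+ 3 + -1 * `|-1 * y + r| ^+ 3) / 12 : R) (avg_abs r x).
  apply: is_derive_eq (is_derive_norm3_comb _ _ _ _ _ _) _.
  by rewrite /avg_abs !mul1r !mulN1r mulNr opprK [x + r]addrC [- x + r]addrC.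
have cA : continuous (fun x => avg_abs r x).
  by apply: continuous_avg_abs => x; [exact: cvg_cst|exact: cvg_id].
transitivity (\int[mu]_(z in `]0%R, u[) (avg_abs r z)%:E)%E.
  rewrite [LHS]integral_mkcond [RHS]integral_mkcond; apply: eq_integral => z _.
  rewrite !patchE !mem_setE !in_itv/= !andbT.
  by case: (ltP 0 z) => //= z0; case: ifP => _; rewrite ?mul1r ?mul0r.
rewrite -(integral_itv_bndoo true false); last first.
  by apply/measurable_EFinP/measurable_funTS; exact: continuous_measurable_fun.
rewrite (integral_FTC2 (ltW u0) D1 cA); congr EFin.
rewrite !mul1r !mulr0 !add0r !mulN1r subrr mul0r subr0 /avg_prim [- u + r]addrC.
by rewrite (ger0_norm (addr_ge0 (ltW u0) r0)).
Qed.

(** The mean of [avg_abs r] over (0, u) is r^2 / 2 + u^2 / 6 up to u = r and r u / 2 + r^3 / (6 u)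
    beyond. Joining the two primitives at r produces 11 / 36 = 1 / 2 + 1 / 18 - 1 / 4. *)
Lemma integral_posln_avg_abs r v : 0 <= r -> 0 < v ->
  (\int[mu]_(z in D) (posln (v / z) * avg_abs r z)%:E = (log_moment r v)%:E)%E.
Proof.
move=> r0 v0.
pose phi1 u : R := r ^+ 2 / 2 + u ^+ 2 / 6.
pose phi2 u : R := r / 2 * u + r ^+ 3 / 6 * u^-1.
pose phi u := if u <= r then phi1 u else phi2 u.
have c1 : continuous phi1.
  by move=> x; apply: cvgD; [exact: cvg_cst|apply: cvgM; [exact: sqr_continuous|exact: cvg_cst]].
have d1 x : is_derive x (1 : R) (fun u : R => r ^+ 2 / 2 * u + 18^-1 * u ^+ 3) (phi1 x).
  have h := is_deriveD (is_deriveZ (r ^+ 2 / 2) (is_derive_id x (1 : R)))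
    (is_deriveZ 18^-1 (is_deriveX 3 (is_derive_id x (1 : R)))).
  by apply: is_derive_eq h _; rewrite /phi1 /GRing.scale/=; field.
have c2 x : 0 < x -> {for x, continuous phi2}.
  move=> x0; apply: cvgD; first by apply: cvgM; [exact: cvg_cst|exact: cvg_id].
  by apply: cvgM; [exact: cvg_cst|apply: cvgV; [rewrite gt_eqF|exact: cvg_id]].
have d2 x : 0 < x -> is_derive x (1 : R) (fun u : R => r / 4 * u ^+ 2 + r ^+ 3 / 6 * ln u) (phi2 x).
  move=> x0.
  have h := is_deriveD (is_deriveZ (r / 4) (is_deriveX 2 (is_derive_id x (1 : R))))
    (is_deriveZ (r ^+ 3 / 6) (is_derive1_ln x0)).
  by apply: is_derive_eq h _; rewrite /phi2 /GRing.scale/=; field; rewrite gt_eqF.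
rewrite (@integral_posln (avg_abs r) phi)//; last 3 first.
- exact: measurable_avg_abs.
- by move=> z; exact: avg_abs_ge0.
- move=> u u0; rewrite integral_avg_abs0//; congr EFin; rewrite /phi /avg_prim.
  case: leP => ur; first by rewrite ger0_norm ?subr_ge0// /phi1; field.
  by rewrite ltr0_norm ?subr_lt0// /phi2; field; rewrite gt_eqF.
have m1 (S : set R) : measurable_fun S (fun u => (phi1 u)%:E).
  by apply/measurable_EFinP/measurable_funTS; exact: continuous_measurable_fun.
have P1 w : 0 < w -> w <= r -> (\int[mu]_(u in `]0%R, w[) (phi u)%:E =
    (r ^+ 2 / 2 * w + 18^-1 * w ^+ 3)%:E)%E.
  move=> w0 wr; transitivity (\int[mu]_(u in `]0%R, w[) (phi1 u)%:E)%E.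
    apply: eq_integral => u; rewrite inE/= in_itv/= => /andP[_ uw].
    by rewrite /phi (le_trans (ltW uw) wr).
  rewrite -(integral_itv_bndoo true false)//.
  by rewrite (integral_FTC2 (ltW w0) d1 c1) expr0n/= !mulr0 addr0 subr0.
rewrite /log_moment; have [rv|vr] := leP r v; last first.
  by rewrite P1 ?ltW//; congr EFin; field.
have P2 : 0 < r -> (\int[mu]_(u in `[r, v]) (phi u)%:E =
    (r / 4 * v ^+ 2 + r ^+ 3 / 6 * ln v - (r / 4 * r ^+ 2 + r ^+ 3 / 6 * ln r))%:E)%E.
  move=> rp; rewrite -(integral_FTC2_pos rp rv d2 c2); apply: eq_integral => u.
  rewrite inE/= in_itv/= => /andP[ru uv]; rewrite /phi; case: leP => // ur.
  have -> : u = r by apply/le_anti; rewrite ur ru.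
  by congr EFin; rewrite /phi1 /phi2; field; rewrite gt_eqF.
have [r00|rn] := eqVneq r 0.
  rewrite integral0_eq.
    by rewrite r00 expr0n/= !mul0r addr0.
  move=> u; rewrite /= in_itv/= => /andP[u0 _].
  by rewrite /phi leNgt r00 u0/= /phi2 r00 expr0n/= !mul0r addr0.
have rp : 0 < r by rewrite lt_def rn.
have mphi : measurable_fun `]0%R, v[%classic (fun u => (phi u)%:E).
  apply/measurable_EFinP.
  apply: (eq_measurable_fun (fun u => if u <= r then phi1 u else r / 2 * u + r ^+ 3 / 6 * u `^ (-1))).
    move=> u; rewrite inE/= in_itv/= => /andP[u0 _].
    by rewrite /phi /phi2 powR_inv1// ltW.
  apply: measurable_funTS; apply: measurable_fun_ifT => //.
  - exact: measurable_fun_ler.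
  - exact: continuous_measurable_fun.
  - apply: measurable_funD; apply: measurable_funM => //; exact: measurable_powR.
have U : `]0, v[%classic = `]0, r[%classic `|` `[r, v[%classic :> set R.
  apply/seteqP; split => x /=; rewrite !in_itv/=.
    by move=> /andP[-> ->]; case: (ltP x r) => _; [left|right].
  by case=> /andP[h1 h2]; apply/andP; split => //; [exact: lt_le_trans rv|exact: lt_le_trans h1].
rewrite U ge0_integral_setU//.
- rewrite P1// integral_itv_bndo_bndc; last first.
    by apply: measurable_funS mphi => //; rewrite U; exact: subsetUr.
  rewrite P2// -EFinD ln_div ?posrE//; by congr EFin; field.
- by rewrite -U.
- move=> u; rewrite -U /= in_itv/= => /andP[u0 _]; rewrite lee_fin /phi /phi1 /phi2.
  case: ifP => _; first by rewrite addr_ge0// divr_ge0// sqr_ge0.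
  by rewrite addr_ge0// mulr_ge0 ?divr_ge0 ?exprn_ge0 ?invr_ge0 ?(ltW u0)// ltW.
- rewrite disj_set2E; apply/eqP; rewrite -subset0 => x /=; rewrite !in_itv/= => -[/andP[_ h] /andP[h' _]].
  by move: h; rewrite ltNge h'.
Qed.

End mixture.

(** * The product of two generalized normal variables *)

Section density.
Context (R : realType).
Implicit Types (r s t u v x y z a c : R).
Local Notation mu := (@lebesgue_measure R).
Local Notation D := (`]0%R, +oo[%classic : set R).

Lemma Gamma_ge0 s : 0 <= Gamma s.
Proof. by apply: Rintegral_ge0 => t _; rewrite mulr_ge0 ?powR_ge0 ?expR_ge0. Qed.

(* [Gamma] is [0] where its integral diverges. *)
Lemma Gamma_fin s : Gamma s != 0 ->
  ((Gamma s)%:E = \int[mu]_(t in D) (t `^ (s - 1) * expR (- t))%:E)%E.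
Proof.
rewrite /Gamma /Rintegral; set I := (\int[_]_(_ in _) _)%E.
have : (0 <= I)%E by apply: integral_ge0 => t _; rewrite lee_fin mulr_ge0 ?powR_ge0 ?expR_ge0.
by case: I => [x| |]//= _; rewrite eqxx.
Qed.

(** The functional equation of Gamma by Tonelli: t^s is the integral of s u^(s - 1) over u < t, and
    the integral of exp (- t) over t > u is exp (- u). Nonvanishing of [Gamma s] stands for
    convergence. *)
Lemma integral_powR_exp s : 0 < s -> Gamma s != 0 ->
  (\int[mu]_(t in D) (t `^ s * expR (- t))%:E = (s * Gamma s)%:E)%E.
Proof.
move=> s0 G0.
pose k u t : R := (u < t)%R%:R * (s * u `^ (s - 1)).
have k0 u t : 0 <= k u t by rewrite mulr_ge0// mulr_ge0 ?powR_ge0// ltW.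
have mE : measurable_fun setT (fun t : R => expR (- t)).
  by apply: measurableT_comp => //; exact: measurable_funN.
have mk : measurable_fun setT (fun p : R * R => k p.1 p.2).
  apply: measurable_funM; first exact: measurable_ltr_natr.
  apply: measurable_funM => //.
  exact: (measurableT_comp (measurable_powR _) measurable_fst).
transitivity (\int[mu]_(t in D) \int[mu]_(u in D) (expR (- t) * k u t)%:E)%E.
  apply: eq_integral => t; rewrite inE/= in_itv/= andbT => t0.
  rewrite ge0_integralZ_EFin//.
  - by rewrite integral_powR// -EFinM mulrC.
  - apply: measurable_funTS; exact: (measurableT_comp mk (pair2_measurable t)).
rewrite (@tonelliD _ _ _ _ _ mu mu D D (fun t u => (expR (- t) * k u t)%:E))//; last 2 first.
- apply/measurable_EFinP; apply: measurable_funM.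
    exact: (measurableT_comp mE measurable_fst).
  apply: measurable_funM; first exact: measurable_ltr_natr.
  apply: measurable_funM => //.
  exact: (measurableT_comp (measurable_powR _) measurable_snd).
- by move=> t u; rewrite lee_fin mulr_ge0.
rewrite EFinM Gamma_fin// -ge0_integralZ_EFin//; last 3 first.
- by apply: measurable_funTS; apply: measurable_funM => //; exact: measurable_powR.
- by move=> t _; rewrite mulr_ge0 ?powR_ge0.
- exact: ltW.
apply: eq_integral => u; rewrite inE/= in_itv/= andbT => u0.
have E t : expR (- t) * k u t = (s * u `^ (s - 1)) * (expR (- t) * (u < t)%R%:R).
  by rewrite /k; ring.
under eq_integral do rewrite E.
rewrite ge0_integralZ_EFin//.
- by rewrite integral_expN_gt ?ltW// -EFinM mulrA.
- by apply: measurable_funTS; apply: measurable_funM => //; exact: measurable_ltr_natr.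
- by rewrite mulr_ge0 ?powR_ge0// ltW.
Qed.

Lemma measurable_log_moment r d (T : measurableType d) (g : T -> R) :
  measurable_fun setT g -> measurable_fun setT (fun p => log_moment r (g p)).
Proof.
move=> mg; apply: measurable_fun_ifT.
- exact: measurable_fun_ler.
- apply: measurable_funD.
    by apply: measurable_funM => //; apply: measurable_funM => //; exact: measurable_funX.
  apply: measurable_funM => //; apply: measurable_funD => //; apply: measurable_funM => //.
  by apply: (measurableT_comp (@measurable_ln R)); exact: measurable_funM.
- apply: measurable_funD; apply: measurable_funM => //; first exact: measurable_funM.
  exact: measurable_funX.
Qed.

Section bessel_density.
Variables (alpha L A : R).
Hypotheses (alpha0 : 0 < alpha) (L0 : 0 < L) (A0 : 0 <= A).

(** The normalizing constant stays a parameter [A]; unit mass enters later as a hypothesis. *)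
Definition bessel_density z : R :=
  A * besselK0 (2 * L `^ alpha * `|z| `^ (alpha / 2)).

Local Notation f := bessel_density.

Lemma bessel_density_ge0 z : 0 <= f z.
Proof. by rewrite mulr_ge0 ?besselK0_ge0. Qed.

Lemma bessel_densityN z : f (- z) = f z.
Proof. by rewrite /bessel_density normrN. Qed.

Lemma measurable_bessel_density : measurable_fun setT f.
Proof.
apply: measurable_funM => //; apply: measurableT_comp; first exact: measurable_besselK0.
apply: measurable_funM => //; apply: (measurableT_comp (measurable_powR _)).
exact: normr_measurable.
Qed.

Lemma bessel_density_le x y : 0 < x -> x < y -> f y <= f x.
Proof.
move=> x0 xy; have y0 := lt_trans x0 xy.
have c0 : 0 < 2 * L `^ alpha by rewrite mulr_gt0// powR_gt0.
rewrite /bessel_density (gtr0_norm x0) (gtr0_norm y0).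
apply: ler_wpM2l; first exact: A0.
apply: besselK0_le; first by rewrite mulr_gt0// powR_gt0.
apply: ler_wpM2l; first exact: ltW.
apply: ge0_ler_powR; rewrite ?nnegrE ?ltW//.
by rewrite divr_gt0.
Qed.

Let Aa0 : 0 <= A * alpha / 2.
Proof. by apply: divr_ge0 => //; apply: mulr_ge0 A0 _; exact: ltW. Qed.

(** The width at which the logarithm vanishes: it solves t u / (L^alpha z^(alpha / 2))^2 = (w /
    z)^alpha. The exponent alpha comes out of the logarithm as a factor in [posln_bessel]. *)
Let w t u : R := (t * u) `^ alpha^-1 / L ^+ 2.

Let w_gt0 t u : 0 < t -> 0 < u -> 0 < w t u.
Proof. by move=> t0 u0; rewrite divr_gt0 ?exprn_gt0// powR_gt0// mulr_gt0. Qed.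

Let mw : measurable_fun setT (fun p : R * R => w p.1 p.2).
Proof.
apply: measurable_funM => //; apply: (measurableT_comp (measurable_powR _)).
exact: measurable_funM.
Qed.

Lemma posln_bessel z t u : 0 < z -> 0 < t -> 0 < u ->
  posln (t * u / ((2 * L `^ alpha * z `^ (alpha / 2)) / 2) ^+ 2) = alpha * posln (w t u / z).
Proof.
move=> z0 t0 u0.
have La : 0 < L `^ alpha by rewrite powR_gt0.
have za : 0 < z `^ (alpha / 2) by rewrite powR_gt0.
have tu : 0 < t * u by rewrite mulr_gt0.
rewrite /posln -[2 * _ * _]mulrA [2 * _]mulrC mulfK//.
rewrite maxr_pMr ?ltW// mulr0; congr (Num.max _ _).
have lza : 0 < L `^ alpha * z `^ (alpha / 2) by rewrite mulr_gt0.
have q1 : ln (t * u / (L `^ alpha * z `^ (alpha / 2)) ^+ 2) =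
    ln (t * u) - 2 * (alpha * ln L + alpha / 2 * ln z).
  rewrite ln_div ?posrE; [|exact: tu|exact: exprn_gt0].
  rewrite lnXn; last exact: lza.
  rewrite [ln (_ `^ _ * _)]lnM ?posrE; [|exact: La|exact: za].
  by rewrite !ln_powR mulr_natl.
have q2 : ln (w t u / z) = alpha^-1 * ln (t * u) - 2 * ln L - ln z.
  rewrite ln_div ?posrE; [|exact: w_gt0|exact: z0].
  rewrite /w ln_div ?posrE; [|exact: powR_gt0|exact: exprn_gt0].
  by rewrite ln_powR lnXn; [rewrite mulr_natl|exact: L0].
by rewrite q1 q2; field; rewrite gt_eqF.
Qed.

Lemma bessel_densityE z : 0 < z -> ((f z)%:E =
  \int[mu]_(t in D) \int[mu]_(u in D)
    ((A * alpha / 2 * (expR (- t) * expR (- u))) * posln (w t u / z))%:E)%E.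
Proof.
move=> z0; rewrite /bessel_density gtr0_norm//.
set x := 2 * _ * _.
have x0 : 0 < x by rewrite mulr_gt0 ?powR_gt0// mulr_gt0// powR_gt0.
have -> : A * besselK0 x = A / 2 * (2 * besselK0 x) by field.
have m0 : measurable_fun setT (fun p : R * R => expR (- p.1) * (expR (- p.2) * posln (p.1 * p.2 / (x / 2) ^+ 2))).
  apply: measurable_funM; first by apply: measurableT_comp => //; exact: measurable_funN.
  apply: measurable_funM; first by apply: measurableT_comp => //; exact: measurable_funN.
  apply: measurable_posln; apply: measurable_funM => //; exact: measurable_funM.
rewrite EFinM besselK0_mixture//.
(* A zero second summand: the lemma serves to move a scalar into the double integral. *)
have := @integral2_comb R (A / 2) 0 (fun t u => expR (- t) * (expR (- u) * posln (t * u / (x / 2) ^+ 2))) (fun _ _ => 0).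
rewrite mul0e adde0 => <-//; last 2 first.
- by rewrite divr_ge0.
- by move=> t u; rewrite !mulr_ge0 ?posln_ge0.
apply: eq_integral => t; rewrite inE/= in_itv/= andbT => t0.
apply: eq_integral => u; rewrite inE/= in_itv/= andbT => u0.
by congr EFin; rewrite mulr0 addr0 posln_bessel//; field.
Qed.

Lemma integral_bessel_density (psi j : R -> R) :
  measurable_fun setT psi -> (forall z, 0 <= psi z) ->
  (forall v, (0 < v)%R -> \int[mu]_(z in D) (posln (v / z) * psi z)%:E = (j v)%:E)%E ->
  (\int[mu]_(z in D) (psi z * f z)%:E = \int[mu]_(t in D) \int[mu]_(u in D)
    ((A * alpha / 2 * (expR (- t) * expR (- u))) * j (w t u))%:E)%E.
Proof.
move=> mpsi psi0 jE.
pose c t u : R := A * alpha / 2 * (expR (- t) * expR (- u)).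
have c0 t u : 0 <= c t u by apply: mulr_ge0 Aa0 _; exact: mulr_ge0.
pose k z t u : R := c t u * (posln (w t u / z) * psi z).
have k0 z t u : 0 <= k z t u by rewrite mulr_ge0// mulr_ge0 ?posln_ge0.
have mpow : measurable_fun setT (fun z : R => z `^ (-1)) by exact: measurable_powR.
(* [z `^ -1] stands for [z^-1], to which it is equal for [0 < z] *)
pose k' z t u : R := c t u * (posln (w t u * `|z| `^ (-1)) * psi z).
have k'E z t u : 0 < z -> k' z t u = k z t u.
  by move=> z0; rewrite /k' /k gtr0_norm// powR_inv1// ltW.
have k'0 z t u : 0 <= k' z t u by rewrite mulr_ge0// mulr_ge0 ?posln_ge0.
have mk' d (T : measurableType d) (b1 b2 b3 : T -> R) : measurable_fun setT b1 ->
    measurable_fun setT b2 -> measurable_fun setT b3 ->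
    measurable_fun setT (fun p => k' (b1 p) (b2 p) (b3 p)).
  move=> m1 m2 m3; apply: measurable_funM.
    apply: measurable_funM => //; apply: measurable_funM; apply: measurableT_comp => //; exact: measurable_funN.
  apply: measurable_funM; last exact: measurableT_comp.
  apply: measurable_posln; apply: measurable_funM.
    exact: (measurableT_comp mw (measurable_fun_pair m2 m3)).
  by apply: (measurableT_comp mpow); exact: measurableT_comp.
transitivity (\int[mu]_(z in D) \int[mu]_(t in D) \int[mu]_(u in D) (k' z t u)%:E)%E.
  apply: eq_integral => z; rewrite inE/= in_itv/= andbT => z0.
  rewrite EFinM bessel_densityE//.
  pose h t u : R := c t u * posln (w t u * `|z| `^ (-1)).
  have hE t u : h t u = c t u * posln (w t u / z).
    by rewrite /h gtr0_norm// powR_inv1// ltW.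
  have mh : measurable_fun setT (fun p : R * R => h p.1 p.2).
    apply: measurable_funM.
      by apply: measurable_funM => //; apply: measurable_funM; apply: measurableT_comp => //; exact: measurable_funN.
    by apply: measurable_posln; exact: measurable_funM.
  have := @integral2_comb R (psi z) 0 h (fun _ _ => 0) (psi0 z) (lexx _) mh.
  rewrite mul0e adde0 => H.
  transitivity ((psi z)%:E * (\int[mu]_(t in D) \int[mu]_(u in D) (h t u)%:E))%E.
    by congr (_ * _)%E; apply: eq_integral => t _; apply: eq_integral => u _; rewrite hE.
  rewrite -H//; last by move=> t u; rewrite mulr_ge0// posln_ge0.
  apply: eq_integral => t _; apply: eq_integral => u _; congr EFin.
  by rewrite mulr0 addr0 /k' /h; ring.
rewrite (@tonelliD _ _ _ _ _ mu mu D D (fun z t => \int[mu]_(u in D) (k' z t u)%:E)%E)//; last 2 first.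
- apply: (measurable_integralD_r mu (f := fun (p : R * R) u => k' p.1 p.2 u)) => //.
  by apply: mk' => //; exact: measurableT_comp.
- by move=> s t; apply: integral_ge0 => u _; rewrite lee_fin.
apply: eq_integral => t; rewrite inE/= in_itv/= andbT => t0.
rewrite (@tonelliD _ _ _ _ _ mu mu D D (fun z u => (k' z t u)%:E)%E)//; last 2 first.
- exact/measurable_EFinP/mk'.
- by move=> *; rewrite lee_fin.
apply: eq_integral => u; rewrite inE/= in_itv/= andbT => u0.
rewrite [RHS]EFinM -jE ?w_gt0// -ge0_integralZ_EFin//.
- by apply: eq_integral => z; rewrite inE/= in_itv/= andbT => z0; rewrite k'E.
- apply: (eq_measurable_fun (fun z => posln (w t u * `|z| `^ (-1)) * psi z)).
    by move=> z; rewrite inE/= in_itv/= andbT => z0; rewrite gtr0_norm// powR_inv1// ltW.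
  apply: measurable_funTS; apply: measurable_funM => //; apply: measurable_posln.
  apply: measurable_funM => //; apply: (measurableT_comp mpow); exact: normr_measurable.
- by move=> z _; rewrite mulr_ge0 ?posln_ge0.
- exact: c0.
Qed.

(** Since log_+(w / z) has integral w over z > 0, the density has unit mass exactly when 2 e w is a
    probability density in (t, u); this is the mixing law of the widths. *)
Let e t u : R := A * alpha / 2 * (expR (- t) * expR (- u)).

Let e0 t u : 0 <= e t u.
Proof. by apply: mulr_ge0 Aa0 _; exact: mulr_ge0. Qed.

Let me : measurable_fun setT (fun p : R * R => e p.1 p.2).
Proof.
apply: measurable_funM => //; apply: measurable_funM.
  by apply: measurableT_comp => //; exact: measurable_funN.
by apply: measurableT_comp => //; exact: measurable_funN.
Qed.

(** The square of the width is a product of powers of t and u, so the double integral splits into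
    two copies of the Gamma integral at 2 / alpha + 1. *)
Lemma bessel_density_second_moment : Gamma (2 / alpha) != 0 ->
  (\int[mu]_(t in D) \int[mu]_(u in D) (e t u * w t u ^+ 2)%:E =
   (2 * A * Gamma (2 / alpha) ^+ 2 / (alpha * L ^+ 4))%:E)%E.
Proof.
move=> G0; set G := Gamma _ in G0 *.
have s0 : 0 < 2 / alpha by rewrite divr_gt0.
pose q t : R := t `^ (2 / alpha) * expR (- t).
have q0 t : 0 <= q t by rewrite mulr_ge0 ?powR_ge0.
have mq : measurable_fun setT q.
  apply: measurable_funM; first exact: measurable_powR.
  by apply: measurableT_comp => //; exact: measurable_funN.
pose C : R := A * alpha / 2 / L ^+ 4.
have C0 : 0 <= C by apply: divr_ge0 Aa0 _; exact/exprn_ge0/ltW.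
have E t u : 0 < t -> 0 < u -> e t u * w t u ^+ 2 = C * q t * q u.
  move=> t0 u0.
  have pw : ((t * u) `^ alpha^-1) ^+ 2 = t `^ (2 / alpha) * u `^ (2 / alpha).
    rewrite -(powR_mulrn 2 (powR_ge0 _ _)) -powRrM [alpha^-1 * _]mulrC.
    exact: powRM (ltW t0) (ltW u0).
  rewrite /e /w exprMn pw /q /C; field.
  by rewrite gt_eqF.
have Iq : (\int[mu]_(t in D) (q t)%:E = (2 / alpha * G)%:E)%E by exact: integral_powR_exp.
have qG0 : 0 <= 2 / alpha * G by rewrite mulr_ge0 ?Gamma_ge0// ltW.
transitivity (\int[mu]_(t in D) ((C * (2 / alpha * G)) * q t)%:E)%E.
  apply: eq_integral => t; rewrite inE/= in_itv/= andbT => t0.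
  transitivity (\int[mu]_(u in D) (C * q t * q u)%:E)%E.
    by apply: eq_integral => u; rewrite inE/= in_itv/= andbT => u0; rewrite E.
  rewrite ge0_integralZ_EFin; [|exact: measurable_itv|exact: measurable_funTS|by move=> u _; exact: q0|exact: mulr_ge0].
  by rewrite Iq -EFinM; congr EFin; ring.
rewrite ge0_integralZ_EFin; [|exact: measurable_itv|exact: measurable_funTS|by move=> u _; exact: q0|exact: mulr_ge0].
by rewrite Iq -EFinM; congr EFin; rewrite /C; field; rewrite !gt_eqF.
Qed.

(** Jensen's inequality with the mixing density 2 e w: [M1] is its total mass and [M2] says that the
    mean width is l, so the tangent at l integrates to exactly [log_profile r l]. *)
Lemma integral_avg_abs_bessel_density r l : 0 <= r ->
  (\int[mu]_z (f z)%:E = 1)%E -> Gamma (2 / alpha) != 0 ->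
  l = 4 * A * Gamma (2 / alpha) ^+ 2 / (alpha * L ^+ 4) -> 0 < l ->
  ((log_profile r l)%:E <= \int[mu]_z (avg_abs r z * f z)%:E)%E.
Proof.
move=> r0 f1 G0 lE l0.
have mf := measurable_bessel_density.
have [b0 [b1 [b00 b10 <- bl]]] := log_moment_tangent r0 l0.
have M1 : (2%:E * \int[mu]_(t in D) \int[mu]_(u in D) (e t u * w t u)%:E = 1)%E.
  have J1 v : 0 < v -> (\int[mu]_(z in D) (posln (v / z) * 1)%:E = (id v)%:E)%E.
    by move=> v0; under eq_integral do rewrite mulr1; exact: integral_posln_cst.
  have m1 : measurable_fun setT (fun _ : R => 1 : R) by [].
  have I1 := @integral_bessel_density (fun=> 1) id m1 (fun=> ler01) J1.
  rewrite -I1; apply: etrans f1.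
  rewrite (ge0_integral_even mf bessel_density_ge0 bessel_densityN); congr (_ * _)%E.
  by apply: eq_integral => z _; rewrite mul1r.
have M2 : (2%:E * \int[mu]_(t in D) \int[mu]_(u in D) (e t u * w t u ^+ 2)%:E = l%:E)%E.
  rewrite bessel_density_second_moment; last exact: G0.
  rewrite -EFinM lE; congr EFin; field.
  by rewrite !gt_eqF.
have mAf : measurable_fun setT (fun z => avg_abs r z * f z).
  by apply: measurable_funM mf; apply: measurable_avg_abs => //.
rewrite (ge0_integral_even mAf); last 2 first.
- by move=> z; apply: mulr_ge0; [exact: avg_abs_ge0|exact: bessel_density_ge0].
- by move=> z; rewrite avg_absN bessel_densityN.
have J2 v : 0 < v -> (\int[mu]_(z in D) (posln (v / z) * avg_abs r z)%:E = (log_moment r v)%:E)%E.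
  exact: integral_posln_avg_abs.
have mA : measurable_fun setT (avg_abs r) by exact: measurable_avg_abs.
rewrite (integral_bessel_density mA (fun z => avg_abs_ge0 z r0) J2).
have mew : measurable_fun setT (fun p : R * R => e p.1 p.2 * w p.1 p.2) by exact: measurable_funM.
have mew2 : measurable_fun setT (fun p : R * R => e p.1 p.2 * w p.1 p.2 ^+ 2).
  by apply: measurable_funM => //; exact: measurable_funX.
have w0 t u : 0 <= w t u by rewrite divr_ge0 ?powR_ge0// exprn_ge0// ltW.
have := integral2_comb b00 b10 mew mew2 (fun t u => mulr_ge0 (e0 t u) (w0 t u))
  (fun t u => mulr_ge0 (e0 t u) (exprn_ge0 2 (w0 t u))).
move=> H.
have -> : (b0 + b1 * l)%:E = (2%:E * \int[mu]_(t in D) \int[mu]_(u in D)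
    (b0 * (e t u * w t u) + b1 * (e t u * w t u ^+ 2))%:E)%E.
  rewrite H ge0_muleDr; last 2 first.
  - by rewrite mule_ge0 ?lee_fin//; do 2 (apply: integral_ge0 => ? _); rewrite lee_fin mulr_ge0.
  - by rewrite mule_ge0 ?lee_fin//; do 2 (apply: integral_ge0 => ? _); rewrite lee_fin mulr_ge0// exprn_ge0.
  by rewrite ![(2%:E * (_ * _))%E]muleCA M1 M2 mule1 -EFinM EFinD.
rewrite lee_pmul2l//.
have mlm : measurable_fun setT (fun p : R * R => e p.1 p.2 * log_moment r (w p.1 p.2)).
  by apply: measurable_funM me _; exact: measurable_log_moment.
have mcb : measurable_fun setT (fun p : R * R => b0 * (e p.1 p.2 * w p.1 p.2) + b1 * (e p.1 p.2 * w p.1 p.2 ^+ 2)).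
  by apply: measurable_funD; exact: measurable_funM.
have cb0 t u : 0 <= b0 * (e t u * w t u) + b1 * (e t u * w t u ^+ 2).
  apply: addr_ge0; first exact/mulr_ge0/mulr_ge0/w0/e0.
  exact/mulr_ge0/mulr_ge0/exprn_ge0/w0/e0.
have lm0 t u : 0 < t -> 0 < u -> b0 * (e t u * w t u) + b1 * (e t u * w t u ^+ 2) <= e t u * log_moment r (w t u).
  move=> t0 u0; have := ler_wpM2l (e0 t u) (bl _ (w_gt0 t0 u0)); apply: le_trans.
  by rewrite le_eqVlt; apply/orP; left; apply/eqP; ring.
(* The absolute value makes the integrand nonnegative outside of the domain too. *)
pose k t u : R := `|e t u * log_moment r (w t u)|.
have mk : measurable_fun setT (fun p : R * R => k p.1 p.2).
  by apply: (measurableT_comp _ mlm); exact: normr_measurable.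
have kE t u : 0 < t -> 0 < u -> k t u = e t u * log_moment r (w t u).
  by move=> t0 u0; rewrite /k ger0_norm// (le_trans _ (lm0 _ _ t0 u0)).
apply: (@le_trans _ _ (\int[mu]_(t in D) \int[mu]_(u in D) (k t u)%:E)%E).
  apply: ge0_le_integral.
  - exact: measurable_itv.
  - by move=> t _; apply: integral_ge0 => u _; rewrite lee_fin cb0.
  - by apply: measurable_funTS; exact: (measurable_integralD_r mu (measurable_itv _) mcb cb0).
  - by apply: measurable_funTS; exact: (measurable_integralD_r mu (measurable_itv _) mk (fun _ _ => normr_ge0 _)).
  - move=> t; rewrite /= in_itv/= andbT => t0; apply: ge0_le_integral.
    + exact: measurable_itv.
    + by move=> u _; rewrite lee_fin cb0.
    + by apply/measurable_EFinP/measurable_funTS; exact: (measurableT_comp mcb (pair1_measurable t)).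
    + by apply/measurable_EFinP/measurable_funTS; exact: (measurableT_comp mk (pair1_measurable t)).
    + by move=> u; rewrite /= in_itv/= andbT => u0; rewrite lee_fin kE//; exact: lm0.
rewrite le_eqVlt; apply/orP; left; apply/eqP.
apply: eq_integral => t; rewrite inE/= in_itv/= andbT => t0.
by apply: eq_integral => u; rewrite inE/= in_itv/= andbT => u0; rewrite kE.
Qed.

End bessel_density.
End density.

(** * Partial sums of independent variables *)

Section independence.
Context (R : realType) d (T : measurableType d) (P : probability T R).
Local Open Scope ereal_scope.

Lemma exists_mfun d' (T' : measurableType d') (f : T -> T') : measurable_fun setT f ->
  exists g : {mfun T >-> T'}, g = f :> (T -> T').
Proof. by move=> mf; exists (mfun_Sub (mem_set mf)); exact: mfun_valP. Qed.

(** Uniqueness of the product measure, determined by rectangles. E will be an event about later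
    variables; its probability is absorbed as a scalar into the first factor, so that the law
    restricted to E is itself a product. *)
Lemma joint_law_cond (S Y : {RV P >-> R}) (E : set T) : measurable E ->
  (forall A B : set R, measurable A -> measurable B ->
    P ((S @^-1` A `&` Y @^-1` B) `&` E) = P (S @^-1` A) * P (Y @^-1` B) * P E) ->
  forall C : set (R * R), measurable C ->
    P ((fun w => (S w, Y w)) @^-1` C `&` E) =
    (distribution P S \x distribution P Y) C * P E.
Proof.
move=> mE rect C mC.
have [Z ZE] := exists_mfun (measurable_fun_pair (measurable_funPT S) (measurable_funPT Y)).
have ZP D : Z @^-1` D = (fun w => (S w, Y w)) @^-1` D by rewrite ZE.
have pE0 : (0 <= fine (P E))%R by exact: fine_ge0.
pose p : {nonneg R} := NngNum pE0.
have pE : p%:num%:E = P E by rewrite /= fineK// fin_num_measure.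
pose m1 := mscale p (distribution P S).
have e1 : (m1 \x distribution P Y) C = pushforward (mrestr P mE) Z C.
  apply: product_measure_unique => // A B mA mB.
  transitivity (P (Z @^-1` (A `*` B) `&` E)); first by [].
  rewrite ZP; transitivity (P ((S @^-1` A `&` Y @^-1` B) `&` E)); first by [].
  transitivity (p%:num%:E * P (S @^-1` A) * P (Y @^-1` B)); last by [].
  by rewrite rect// pE muleC muleA.
have e2 : (m1 \x distribution P Y) C = mscale p (distribution P S \x distribution P Y) C.
  apply: product_measure_unique => // A B mA mB.
  transitivity (p%:num%:E * (distribution P S \x distribution P Y) (A `*` B)); first by [].
  rewrite product_measure1E; [|exact: mA|exact: mB].
  transitivity (p%:num%:E * distribution P S A * distribution P Y B); last by [].
  by rewrite muleA.
rewrite -ZP; transitivity (pushforward (mrestr P mE) Z C); first by [].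
by rewrite -e1 e2 /mscale pE muleC.
Qed.

Variable X : nat -> {RV P >-> R}.
Hypothesis indep : mutually_independent P (fun i => X i : T -> R).

Let S n w : R := (\sum_(i < n) X i w)%R.

Lemma measurable_partial_sum n : measurable_fun setT (S n).
Proof. by apply: measurable_sum => i; exact: measurable_funPT. Qed.

Let cyl s B : set T := \big[setI/setT]_(i <- s) (X i @^-1` B i).

Lemma measurable_cyl s B : (forall i, measurable (B i)) -> measurable (cyl s B).
Proof.
move=> mB; rewrite /cyl; elim/big_ind : _ => //; first by move=> ? ?; exact: measurableI.
by move=> i _; exact: measurable_funPTI.
Qed.

(** The event on [X n] joins the cylinder as one more index. This is why the assumed independence of
    the sum admits indices from n on, while the conclusion keeps those after n. *)
Lemma partial_sum_step n (Sn : {RV P >-> R}) s B : Sn = S n :> (T -> R) ->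
  uniq s -> (forall i, i \in s -> (n < i)%N) -> (forall i, measurable (B i)) ->
  (forall A s B, measurable A -> uniq s -> (forall i, i \in s -> (n <= i)%N) ->
    (forall i, measurable (B i)) -> P (S n @^-1` A `&` cyl s B) = P (S n @^-1` A) * P (cyl s B)) ->
  forall C : set (R * R), measurable C ->
    P ((fun w => (Sn w, X n w)) @^-1` C `&` cyl s B) =
    (distribution P Sn \x distribution P (X n)) C * P (cyl s B).
Proof.
move=> SnE us ns mB IH; apply: joint_law_cond; first exact: measurable_cyl.
move=> A B0 mA mB0; rewrite SnE.
pose B' i := if i == n then B0 else B i.
have mB' i : measurable (B' i) by rewrite /B'; case: ifP.
have nns : n \notin s by apply/negP => /ns; rewrite ltnn.
have cE : cyl s B' = cyl s B.
  rewrite /cyl !big_seq; apply: eq_bigr => i /ns ni.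
  by rewrite /B' gtn_eqF.
have cE' : cyl (n :: s) B' = X n @^-1` B0 `&` cyl s B.
  by rewrite {1}/cyl big_cons -/(cyl s B') cE /B' eqxx.
have Pc : P (cyl (n :: s) B') = P (X n @^-1` B0) * P (cyl s B).
  rewrite -cE /cyl !indep//=; last by rewrite nns.
  by rewrite big_cons /B' eqxx.
rewrite -setIA -cE' IH//=.
- by rewrite Pc muleA.
- by rewrite nns.
- by move=> i; rewrite inE => /predU1P[->//|/ns/ltnW].
Qed.

(** The hypothesis on X speaks of cylinders in the coordinates, not of functions of several
    variables, so the induction carries an arbitrary cylinder of later variables along. The next sum
    is a function of the current one and of the new term, whose joint law is a product even on that
    cylinder. *)
Lemma partial_sum_indep n A s B : measurable A -> uniq s -> (forall i, i \in s -> (n <= i)%N) ->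
    (forall i, measurable (B i)) -> P (S n @^-1` A `&` cyl s B) = P (S n @^-1` A) * P (cyl s B).
Proof.
elim: n A s B => [|n IH] A s B mA us ns mB.
  have S0 w : S 0 w = 0%R by rewrite /S big_ord0.
  have [A0|A0] := pselect (A 0%R).
    have -> : S 0 @^-1` A = setT by apply/seteqP; split => w //= _; rewrite S0.
    by rewrite setTI probability_setT mul1e.
  have -> : S 0 @^-1` A = set0 by apply/seteqP; split => w //=; rewrite S0.
  by rewrite set0I measure0 mul0e.
have [Sn SnE] := exists_mfun (measurable_partial_sum n).
pose C : set (R * R) := [set p | A (p.1 + p.2)%R].
have mC : measurable C.
  rewrite -[C]setTI; apply: (measurable_funD measurable_fst measurable_snd) => //.
have CE : S n.+1 @^-1` A = (fun w => (Sn w, X n w)) @^-1` C.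
  by apply/seteqP; split => w /=; rewrite /C/= /S big_ord_recr/= SnE.
have st := partial_sum_step SnE.
rewrite CE (st s B us ns mB IH C mC).
(* The empty cylinder is the whole space, which yields the unconditioned law of the new sum. *)
have := st [::] B isT (fun _ => ltac:(by [])) mB IH C mC.
by rewrite {1 2}/cyl big_nil setIT probability_setT mule1 => ->.
Qed.

Lemma expectation_partial_sumS n (Sn : {RV P >-> R}) (H : R -> R) : Sn = S n :> (T -> R) ->
  measurable_fun setT H -> (forall x, (0 <= H x)%R) ->
  \int[P]_w (H (S n.+1 w))%:E =
  \int[distribution P Sn]_s \int[distribution P (X n)]_x (H (s + x)%R)%:E.
Proof.
move=> SnE mH H0.
have [Z ZE] := exists_mfun (measurable_fun_pair (measurable_funPT Sn) (measurable_funPT (X n))).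
pose h (p : R * R) : \bar R := (H (p.1 + p.2)%R)%:E.
have mh : measurable_fun setT h.
  apply/measurable_EFinP; apply: (measurableT_comp mH).
  exact: (measurable_funD measurable_fst measurable_snd).
transitivity (\int[P]_w (h \o Z) w).
  by apply: eq_integral => w _; rewrite /= ZE /h /S big_ord_recr/= SnE.
rewrite -(ge0_integral_distribution Z mh); last by move=> p; rewrite lee_fin.
transitivity (\int[distribution P Sn \x distribution P (X n)]_p h p).
  apply: eq_measure_integral => C mC _.
  have := partial_sum_step SnE (s := [::]) (B := fun=> setT) isT (fun _ => ltac:(by []))
    (fun=> measurableT) (@partial_sum_indep n) mC.
  rewrite {1 2}/cyl big_nil setIT probability_setT mule1 => e.
  have ZP : distribution P Z C = P ((fun w => (Sn w, X n w)) @^-1` C).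
    by rewrite /distribution /pushforward ZE.
  exact: etrans ZP e.
by rewrite (fubini_tonelli1 _ mh)// => p; rewrite lee_fin.
Qed.

End independence.

(** * Exchange of the terms for Gaussian ones, and the limit r -> 0 *)

(** Pushing the normal law forward along the identity moves it from [measurableTypeR R] to [R],
    where the laws of the variables live. *)
Lemma exists_gauss_prob (R : realType) (c : R) : exists N : probability R R,
  forall A, measurable A -> (N A = \int[@lebesgue_measure R]_(x in A) (gauss_pdf c x)%:E)%E.
Proof.
have mid : measurable_fun setT (id : measurableTypeR R -> R).
  by move=> _ A mA; rewrite setTI.
have [g gE] := exists_mfun mid.
exists (distribution (normal_prob 0 (Num.sqrt c)) g) => A mA.
have gA : g @^-1` A = A by rewrite gE.
by apply: etrans (congr1 (normal_prob 0 (Num.sqrt c)) (_ : g @^-1` A = A)) _; rewrite ?gA.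
Qed.

Section comparison.
Context (R : realType) d (T : measurableType d) (P : probability T R).
Local Notation mu := (@lebesgue_measure R).
Implicit Types r l c : R.

Lemma ge0_integral_density2 (nu : {sigma_finite_measure set R -> \bar R}) (f : R -> R)
    (h : R -> R -> R) :
  measurable_fun setT f -> (forall x, 0 <= f x) ->
  (forall A, measurable A -> nu A = \int[mu]_(x in A) (f x)%:E)%E ->
  measurable_fun setT (fun p : R * R => h p.1 p.2) -> (forall x y, 0 <= h x y) ->
  (\int[nu]_x \int[mu]_y (h x y)%:E = \int[mu]_x \int[mu]_y (h x y * f x)%:E)%E.
Proof.
move=> mf f0 nuE mh h0.
rewrite (@tonelliD _ _ _ _ _ nu mu setT setT (fun x y => (h x y)%:E))//; last exact/measurable_EFinP.
rewrite [RHS](@tonelliD _ _ _ _ _ mu mu setT setT (fun x y => (h x y * f x)%:E))//.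
- apply: eq_integral => y _; apply: ge0_integral_density => //.
  exact: (measurableT_comp mh (pair2_measurable y)).
- apply/measurable_EFinP; apply: measurable_funM mh _.
  exact: (measurableT_comp mf measurable_fst).
- by move=> x y; rewrite lee_fin mulr_ge0.
Qed.

Variable X : nat -> {RV P >-> R}.
Hypothesis indep : mutually_independent P (fun i => X i : T -> R).
Variables (f : R -> R) (l : R).
Hypotheses (mf : measurable_fun setT f) (f0 : forall x, 0 <= f x)
  (fN : forall x, f (- x) = f x) (fni : forall x y, 0 < x -> x < y -> f y <= f x).
Hypothesis lawX : forall i A, measurable A ->
  (distribution P (X i) A = \int[mu]_(x in A) (f x)%:E)%E.
Hypothesis l0 : 0 < l.
Hypothesis f_profile : forall r, 0 <= r ->
  ((log_profile r l)%:E <= \int[mu]_z (avg_abs r z * f z)%:E)%E.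

Let v : R := pi * l ^+ 2 / 32.

Let v0 : 0 < v.
Proof. by rewrite /v !mulr_gt0 ?pi_gt0 ?exprn_gt0. Qed.

Let base r : 0 <= r ->
  (\int[mu]_x (avg_abs r x * gauss_pdf v x)%:E <= \int[mu]_x (avg_abs r x * f x)%:E)%E.
Proof. by move=> r0; apply: le_trans (f_profile r0); exact: integral_avg_abs_gauss_le. Qed.

Lemma integral_avg_abs_partial_sum n r : 0 <= r ->
  (\int[mu]_x (avg_abs r x * gauss_pdf (v *+ n.+1) x)%:E <=
   \int[P]_w (avg_abs r (\sum_(i < n.+1) X i w))%:E)%E.
Proof.
elim: n r => [|n IH] r r0.
  rewrite mulr1n; apply: le_trans (base r0) _.
  under [leRHS]eq_integral do rewrite big_ord1.
  have mA : measurable_fun setT (avg_abs r) by exact: measurable_avg_abs.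
  rewrite -(ge0_integral_density mf f0 (@lawX 0))//; last by move=> x; exact: avg_abs_ge0.
  rewrite ge0_integral_distribution//; first exact/measurable_EFinP.
  by move=> x; rewrite lee_fin avg_abs_ge0.
have [Sn SnE] := exists_mfun (measurable_partial_sum X n.+1).
have mA : measurable_fun setT (avg_abs r) by exact: measurable_avg_abs.
have A0 s : 0 <= avg_abs r s by exact: avg_abs_ge0.
rewrite (expectation_partial_sumS indep SnE mA A0).
pose vn : R := v *+ n.+1.
have vn0 : 0 < vn by rewrite /vn pmulrn_lgt0.
have [N1 N1E] := exists_gauss_prob v.
have [Nn NnE] := exists_gauss_prob vn.
pose g := gauss_pdf vn.
have mg : measurable_fun setT g by exact: measurable_gauss_pdf.
have g0 x : 0 <= g x by exact: gauss_pdf_ge0.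
have mAD : measurable_fun setT (fun p : R * R => avg_abs r (p.1 + p.2)).
  by apply: measurable_avg_abs => //; exact: measurable_funD.
have mAf : measurable_fun setT (fun p : R * R => avg_abs r (p.1 + p.2) * f p.2).
  exact: measurable_funM mAD (measurableT_comp mf measurable_snd).
have mAg : measurable_fun setT (fun p : R * R => avg_abs r (p.1 + p.2) * g p.2).
  exact: measurable_funM mAD (measurableT_comp mg measurable_snd).
have fi : (\int[mu]_x (f x)%:E < +oo)%E.
  by rewrite -(lawX 0 measurableT) probability_setT ltry.
have gi : (\int[mu]_x (g x)%:E < +oo)%E by rewrite integral_gauss_pdf ltry.
rewrite (_ : (\int[mu]_x _)%E = (\int[mu]_x \int[mu]_s (avg_abs r (x + s) * g s * gauss_pdf v x)%:E)%E); last first.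
  by rewrite integral_avg_abs_gauss_conv//; congr integral; apply/funext => x; rewrite mulrS.
have nuX : (\int[distribution P (X n.+1)]_x \int[mu]_s (avg_abs r (x + s) * g s)%:E =
    \int[mu]_x \int[mu]_s (avg_abs r (x + s) * g s * f x)%:E)%E.
  apply: (ge0_integral_density2 (h := fun x s => avg_abs r (x + s) * g s) mf f0 (@lawX n.+1) mAg).
  by move=> x s; rewrite mulr_ge0.
have nuN1 : (\int[N1]_x \int[mu]_s (avg_abs r (x + s) * g s)%:E =
    \int[mu]_x \int[mu]_s (avg_abs r (x + s) * g s * gauss_pdf v x)%:E)%E.
  apply: (ge0_integral_density2 (h := fun x s => avg_abs r (x + s) * g s)
    (measurable_gauss_pdf v) (gauss_pdf_ge0 v) N1E mAg).
  by move=> x s; rewrite mulr_ge0.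
have nuN : (\int[Nn]_s \int[mu]_x (avg_abs r (s + x) * f x)%:E =
    \int[mu]_s \int[mu]_x (avg_abs r (s + x) * f x * g s)%:E)%E.
  apply: (ge0_integral_density2 (h := fun s x => avg_abs r (s + x) * f x) mg g0 NnE mAf).
  by move=> s x; rewrite mulr_ge0.
have swap : (\int[mu]_s \int[mu]_x (avg_abs r (s + x) * f x * g s)%:E =
    \int[mu]_x \int[mu]_s (avg_abs r (x + s) * g s * f x)%:E)%E.
  rewrite (@tonelliD _ _ _ _ _ mu mu setT setT (fun s x => (avg_abs r (s + x) * f x * g s)%:E)).
  - by apply: eq_integral => x _; apply: eq_integral => s _; congr EFin; rewrite [s + x]addrC mulrAC.
  - by [].
  - by [].
  - by apply/measurable_EFinP; exact: measurable_funM mAf (measurableT_comp mg measurable_fst).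
  - by move=> s x; rewrite lee_fin mulr_ge0// mulr_ge0.
rewrite -nuN1.
(* The Gaussian copy of the new term is exchanged for the term itself; the fixed unimodal summand is
   the Gaussian of variance [vn]. *)
apply: (@le_trans _ _ (\int[distribution P (X n.+1)]_x \int[mu]_s (avg_abs r (x + s) * g s)%:E)%E).
  apply: (le_integral_avg_abs_conv mg g0 _ _ gi _ r0).
  - by move=> x; exact: gauss_pdfN.
  - by move=> x y; exact: gauss_pdf_le.
  move=> r' r'0; have mA' : measurable_fun setT (avg_abs r') by exact: measurable_avg_abs.
  rewrite (ge0_integral_density mf f0 (@lawX n.+1) mA' (fun s => avg_abs_ge0 s r'0)).
  rewrite (ge0_integral_density (measurable_gauss_pdf v) (gauss_pdf_ge0 v) N1E mA' (fun s => avg_abs_ge0 s r'0)).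
  exact: base.
rewrite nuX -swap -nuN.
rewrite [leRHS](_ : _ = (\int[distribution P Sn]_s \int[mu]_x (avg_abs r (s + x) * f x)%:E)%E); last first.
  apply: eq_integral => s _.
  apply: (ge0_integral_density (g := fun x => avg_abs r (s + x)) mf f0 (@lawX n.+1)).
  - by apply: measurable_avg_abs => //; exact: measurable_funD.
  - by move=> x; exact: A0.
(* The Gaussian of variance [vn] is exchanged for the sum of the earlier terms; the fixed summand is
   now the new term, of density f. The shape of the law of the sum thus never comes into
   question. *)
apply: (le_integral_avg_abs_conv mf f0 fN fni fi _ r0).
move=> r' r'0; have mA' : measurable_fun setT (avg_abs r') by exact: measurable_avg_abs.
rewrite (ge0_integral_density mg g0 NnE mA' (fun s => avg_abs_ge0 s r'0)).
rewrite ge0_integral_distribution; last 2 first.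
- exact/measurable_EFinP.
- by move=> x; rewrite lee_fin avg_abs_ge0.
by apply: le_trans (IH _ r'0) _; rewrite SnE.
Qed.

Lemma expectation_norm_partial_sum n :
  ((Num.sqrt n.+1%:R * (l / 4))%:E <= \int[P]_w (`|\sum_(i < n.+1) X i w|)%:E)%E.
Proof.
set e := (\int[P]_w _)%E.
pose vn : R := v *+ n.+1.
have vn0 : 0 < vn by rewrite /vn pmulrn_lgt0.
have mS : measurable_fun setT (fun w => \sum_(i < n.+1) X i w).
  exact: (measurable_partial_sum X n.+1).
have mnS : measurable_fun setT (fun w => `|\sum_(i < n.+1) X i w|).
  exact: (measurableT_comp (@normr_measurable R setT) mS).
(* The first absolute moment of the centred Gaussian law of variance [vn]. *)
pose c : R := 2 * vn / Num.sqrt (2 * pi * vn).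
have -> : Num.sqrt n.+1%:R * (l / 4) = c.
  have nE : n.+1%:R = Num.sqrt n.+1%:R ^+ 2 :> R by rewrite sqr_sqrtr.
  have sn0 : 0 < Num.sqrt n.+1%:R :> R by rewrite sqrtr_gt0.
  have vnE : vn = v * Num.sqrt n.+1%:R ^+ 2 by rewrite -nE mulr_natr.
  have p0 := pi_gt0 R.
  rewrite /c vnE (_ : 2 * pi * _ = (Num.sqrt n.+1%:R * pi * l / 4) ^+ 2); last first.
    by rewrite /v; move: p0; generalize (pi : R) => p p0; field.
  rewrite sqrtr_sqr ger0_norm; last by rewrite !mulr_ge0 ?ltW.
  rewrite /v; move: p0; generalize (pi : R) => p p0; field.
  by rewrite !gt_eqF.
have key r : 0 < r -> ((r * c)%:E <= r%:E * e + (r ^+ 2 / 2)%:E)%E.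
  move=> r0; apply: (@le_trans _ _ (\int[mu]_x (avg_abs r x * gauss_pdf vn x)%:E)%E).
    rewrite EFinM -(integral_norm_gauss vn0) -ge0_integralZ_EFin; last 4 first.
    - exact: measurableT.
    - apply: measurable_funM; first exact: normr_measurable.
      exact: measurable_gauss_pdf.
    - by move=> x _; rewrite mulr_ge0 ?gauss_pdf_ge0.
    - exact: ltW.
    apply: ge0_le_integral.
    - exact: measurableT.
    - by move=> x _; rewrite lee_fin mulr_ge0 ?(ltW r0)// mulr_ge0 ?gauss_pdf_ge0.
    - apply/measurable_EFinP; apply: measurable_funM => //.
      apply: measurable_funM; first exact: normr_measurable.
      exact: measurable_gauss_pdf.
    - apply/measurable_EFinP; apply: measurable_funM; first exact: measurable_avg_abs.
      exact: measurable_gauss_pdf.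
    - move=> x _; rewrite lee_fin mulrA; apply: ler_wpM2r; first exact: gauss_pdf_ge0.
      exact/avg_abs_lb/ltW.
  apply: le_trans (integral_avg_abs_partial_sum n (ltW r0)) _.
  apply: (@le_trans _ _ (\int[P]_w ((r * `|\sum_(i < n.+1) X i w|)%:E + (r ^+ 2 / 2)%:E))%E).
    apply: ge0_le_integral.
    - exact: measurableT.
    - by move=> w _; rewrite lee_fin avg_abs_ge0// ltW.
    - by apply/measurable_EFinP; exact: measurable_avg_abs.
    - by apply: emeasurable_funD => //; apply/measurable_EFinP; exact: measurable_funM.
    - by move=> w _; rewrite -EFinD lee_fin; exact/avg_abs_ub/ltW.
  rewrite ge0_integralD; last 5 first.
  - exact: measurableT.
  - by move=> w _; rewrite lee_fin mulr_ge0 ?(ltW r0).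
  - by apply/measurable_EFinP; exact: measurable_funM.
  - by move=> w _; rewrite lee_fin divr_ge0// sqr_ge0.
  - exact: measurable_cst.
  rewrite integral_cst; last exact: measurableT.
  rewrite ge0_integralZ_EFin; last 4 first.
  - exact: measurableT.
  - exact: mnS.
  - by move=> w _; exact: normr_ge0.
  - exact: ltW.
  by rewrite -[in leRHS](mule1 (r ^+ 2 / 2)%:E) -(probability_setT P).
have e0 : (0 <= e)%E by apply: integral_ge0 => w _; rewrite lee_fin.
clearbody e; case: e e0 key => [x| |//]; last by move=> _ _; rewrite leey.
rewrite !lee_fin => x0 key; apply/ler_addgt0Pr => eps eps0.
(* With r = 2 eps the error r^2 / 2, divided by r, is eps. *)
have := key (2 * eps); rewrite mulr_gt0// => /(_ isT); rewrite -EFinM -EFinD lee_fin.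
have -> : 2 * eps * x + (2 * eps) ^+ 2 / 2 = 2 * eps * (x + eps) by field.
by rewrite ler_pM2l// mulr_gt0.
Qed.

End comparison.

Unset Implicit Arguments.

Theorem theorem8 (R : realType) (sigma alpha : R) (d : measure_display)
  (T : measurableType d) (P : probability T R) (X : nat -> {RV P >-> R}) :
  0 < sigma -> 0 < alpha ->
  let Lambda := sigma^-1 * Num.sqrt (Gamma (3 / alpha) / Gamma (1 / alpha)) in
  let f := fun z : R => alpha * Lambda ^+ 2 / Gamma (1 / alpha) ^+ 2 *
             besselK0 (2 * powR Lambda alpha * powR `|z| (alpha / 2)) in
  mutually_independent P (fun i => X i : T -> R) ->
  (forall i, forall A : set R, measurable A ->
     distribution P (X i) A = (\int[@lebesgue_measure R]_(x in A) (f x)%:E)%E) ->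
  (forall i, ('E_P[X i] = 0)%E) ->
  (forall i, ('E_P[fun w => (`|X i w|)%R] < +oo)%E) ->
  forall n : nat, (1 <= n)%N ->
    ((Num.sqrt n%:R * (Gamma (2 / alpha) ^+ 2 /
        (Lambda ^+ 2 * Gamma (1 / alpha) ^+ 2)))%:E
      <= 'E_P[fun w => (`|\sum_(i < n) X i w|)%R])%E
    /\ Num.sqrt n%:R * (Gamma (2 / alpha) ^+ 2 /
        (Lambda ^+ 2 * Gamma (1 / alpha) ^+ 2))
       = Num.sqrt n%:R * (sigma ^+ 2 * Gamma (2 / alpha) ^+ 2 /
        (Gamma (1 / alpha) * Gamma (3 / alpha))).
Proof.
move=> sigma0 alpha0 Lambda f indep lawX _ _ [//|n] _.
pose G1 := Gamma (1 / alpha); pose G2 := Gamma (2 / alpha); pose G3 := Gamma (3 / alpha).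
pose A := alpha * Lambda ^+ 2 / G1 ^+ 2.
have G1ge0 : 0 <= G1 by exact: Gamma_ge0.
have G3ge0 : 0 <= G3 by exact: Gamma_ge0.
have A0 : 0 <= A.
  by apply: divr_ge0; [apply: mulr_ge0; [exact: ltW|exact: sqr_ge0]|exact: sqr_ge0].
have f1 : (\int[@lebesgue_measure R]_z (bessel_density alpha Lambda A z)%:E = 1)%E.
  apply: etrans (esym (lawX 0%N setT measurableT)) _.
  exact: (probability_setT (distribution P (X 0%N))).
(* Nonvanishing of the Gamma values is read off from the unit mass: if [Lambda] or
   [Gamma (1 / alpha)] were 0, then, as 0^-1 = 0, the density would vanish identically. *)
have A_neq0 : A != 0.
  apply/eqP => AE; move: f1; under eq_integral do rewrite /bessel_density AE mul0r.
  by rewrite integral0 => /eqP; rewrite eqe eq_sym oner_eq0.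
have Lambda_neq0 : Lambda != 0.
  by apply: contra_neq A_neq0; rewrite /A => ->; rewrite expr0n/= mulr0 mul0r.
have G1_neq0 : G1 != 0.
  by apply: contra_neq A_neq0; rewrite /A => ->; rewrite expr0n/= invr0 mulr0.
have Lambda0 : 0 < Lambda.
  rewrite lt_neqAle eq_sym Lambda_neq0/=.
  by apply: mulr_ge0; [rewrite invr_ge0; exact: ltW|exact: sqrtr_ge0].
have Lambda2 : Lambda ^+ 2 = (sigma ^+ 2)^-1 * (G3 / G1).
  rewrite /Lambda -/G1 -/G3 exprMn sqr_sqrtr; first by rewrite exprVn.
  exact: divr_ge0.
have G3_neq0 : G3 != 0.
  apply: contra_neq Lambda_neq0 => G3E.
  have /eqP : Lambda ^+ 2 = 0 by rewrite Lambda2 G3E mul0r mulr0.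
  by rewrite expf_eq0/= => /eqP.
have sigma_neq0 : sigma != 0 by rewrite gt_eqF.
rewrite -/G1 -/G2 -/G3; split; last first.
  congr (_ * _); rewrite Lambda2; field.
  by rewrite G1_neq0 G3_neq0 sigma_neq0.
rewrite [X in (_ <= X)%E](_ : _ = (\int[P]_w (`|\sum_(i < n.+1) X i w|)%:E)%E); last first.
  by rewrite unlock.
(* If [Gamma (2 / alpha)] had the default value 0, the lower bound would be 0. Otherwise its
   integral converges and the moment computation applies. *)
have [G2E|G2_neq0] := eqVneq G2 0.
  rewrite G2E expr0n/= mul0r mulr0.
  by apply: integral_ge0 => w _; rewrite lee_fin normr_ge0.
(* The mean width of the mixture; l / 4 is the first absolute moment of one term. *)
pose l := 4 * A * G2 ^+ 2 / (alpha * Lambda ^+ 4).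
have lE : l / 4 = G2 ^+ 2 / (Lambda ^+ 2 * G1 ^+ 2).
  rewrite /l /A; field.
  by rewrite G1_neq0 Lambda_neq0 gt_eqF.
have l0 : 0 < l.
  rewrite /l; apply: divr_gt0; last by apply: mulr_gt0 => //; exact: exprn_gt0.
  apply: mulr_gt0; last by rewrite exprn_even_gt0.
  by apply: mulr_gt0 => //; rewrite lt_neqAle eq_sym A_neq0.
rewrite -lE; apply: (@expectation_norm_partial_sum _ _ _ _ _ indep (bessel_density alpha Lambda A)).
- exact: measurable_bessel_density.
- by move=> x; exact: bessel_density_ge0.
- by move=> x; exact: bessel_densityN.
- by move=> x y x0 xy; exact: bessel_density_le.
- exact: lawX.
- exact: l0.
- move=> r r0; exact: (@integral_avg_abs_bessel_density _ _ _ _ alpha0 Lambda0 A0 r l r0 f1 G2_neq0 erefl l0).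
Qed.
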